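(* Let $w=(w_n)_{n=0}^\infty$ be positive numbers satisfying the following properties: (i) $\liminf_{n} w_n = 0$; (ii) $(w_n)_n$ is non-increasing, or there exists $C>1$ such that for any $n\geq 1$: $C^{-1} w_n \leq w_k \leq C w_n$ for all $n\leq k\leq 2n$. Then the sub-collection of $\mathscr{P}_w$ consisting of those pairs $(\sigma,E)\in\mathscr{P}_w$ for which the positive finite Borel measure $\sigma$ is supported on a set of Lebesgue measure zero, i.e. $m(\operatorname{supp}(\sigma))=0$, is generic in the complete metric space $(\mathscr{P}_w, d_w)$.
   Context: $\mathbb{T}$ is the unit circle and $m$ is the unit-normalized arc-length (Lebesgue) measure on $\mathbb{T}$. For a distribution $S$ on $\mathbb{T}$, $\widehat{S}(n):=S(\zeta^{-n})$, $n\in\mathbb{Z}$, denotes its $n$-th Fourier coefficient. For positive numbers $w=(w_n)_{n=0}^\infty$, $\ell^2(w)$ is the space of distributions $S$ on $\mathbb{T}$ with $\|S\|_{\ell^2(w)}=\left(\sum_{n\in\mathbb{Z}}|\widehat{S}(n)|^2 w_{|n|}\right)^{1/2}<\infty$. $\mathscr{C}$ is the set of non-empty compact subsets of $\mathbb{T}$ with the Hausdorff metric $d_{\mathscr{C}}(E,F):=\sup_{\zeta\in E}\operatorname{dist}(\zeta,F)+\sup_{\xi\in F}\operatorname{dist}(\xi,E)$. $\mathscr{P}_w$ is the collection of ordered pairs $(\sigma,E)\in\ell^2(w)\times\mathscr{C}$ such that (a) $\operatorname{supp}(\sigma)\subseteq E$ and (b) $\sigma$ is a positive finite Borel measure on $\mathbb{T}$.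 It is equipped with the metric $d_w((\sigma,E),(\tau,F))=d_{\mathscr{C}}(E,F)+\|\sigma-\tau\|_{\ell^2(w)}$, with which it is a complete metric space. A subset of a metric space $X$ is generic in $X$ if its complement is meager, i.e. a countable union of nowhere dense sets in $X$. *)

(* Defs.v *)
From HB Require Import structures.
From mathcomp Require Import all_boot all_order all_algebra.
From mathcomp Require Import complex.
From mathcomp Require Import all_classical all_reals all_analysis.
From mathcomp Require Import ring lra.

Set Implicit Arguments.
Unset Strict Implicit.
Unset Printing Implicit Defensive.

Import Order.TTheory GRing.Theory Num.Theory.
Import numFieldNormedType.Exports.

Local Open Scope classical_set_scope.
Local Open Scope ring_scope.
Local Open Scope complex_scope.

Section Generic.
Context {X : topologicalType}.
Implicit Types A : set X.

Definition nowhere_dense A := (closure A)^° = set0.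

Definition meager A :=
  exists2 F : (set X)^nat, (forall k, nowhere_dense (F k)) & A = \bigcup_k F k.

Definition generic A := meager (~` A).

End Generic.

(* The unit circle with the chordal distance |z - y|, the topology it induces
   and the Borel sigma-algebra of that topology. *)
Definition circle (R : realType) : Type := {z : R[i] | `|z| == 1}.

HB.instance Definition _ (R : realType) := Choice.on (circle R).

Section CircleMetric.
Context {R : realType}.
Implicit Types z x y : circle R.

Definition chord x y : R := Normc.normc (val x - val y).

Lemma chord0 x : chord x x = 0.
Proof. by rewrite /chord subrr Normc.normc0. Qed.

Lemma chord_eq0 x y : chord x y = 0 -> x = y.
Proof. by move=> /Normc.eq0_normc/eqP; rewrite subr_eq0 => /eqP/val_inj. Qed.

Lemma chord_sym x y : chord x y = chord y x.
Proof. by rewrite /chord -opprB (normcN (_ : Rcomplex R)). Qed.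

Lemma chord_triangle y x z : chord x z <= chord x y + chord y z.
Proof.
rewrite /chord; have -> : val x - val z = (val x - val y) + (val y - val z).
  by rewrite addrA subrK.
exact: (le_normcD (_ : Rcomplex R)).
Qed.

Lemma circle1_subproof : `|1 : R[i]| == 1.
Proof. by rewrite normr1. Qed.

HB.instance Definition _ := isPointed.Build (circle R)
  (exist _ (1 : R[i]) circle1_subproof).

HB.instance Definition _ :=
  isMetric.Build R (circle R) chord0 chord_eq0 chord_sym chord_triangle.

Lemma mdist_circle x y : mdist x y = Normc.normc (val x - val y).
Proof. by []. Qed.

End CircleMetric.

HB.instance Definition _ (R : realType) :=
  Measurable.copy (circle R) (g_sigma_algebraType (@open (circle R))).

Section ArcLength.
Context {R : realType}.

Lemma expi_subproof (t : R) : `|(cos t +i* sin t : R[i])| == 1.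
Proof.
by rewrite normc_def /= cos2Dsin2 sqrtr1.
Qed.

Definition expi (t : R) : circle R :=
  exist _ (cos t +i* sin t : R[i]) (expi_subproof t).

(* Normalized so that arc_length setT = 1: the image of Lebesgue measure on
   [0, 1[ under t |-> exp (2 i pi t). *)
Definition arc_length (A : set (circle R)) : \bar R :=
  lebesgue_measure (`[0, 1[ `&` [set t | A (expi (2 * pi * t))]).

End ArcLength.

Section HausdorffDistance.
Context {R : realType}.
Implicit Types (x y : circle R) (E F G : set (circle R)).

Definition dist_to x F : R := inf [set mdist x y | y in F].

Definition hdist E F : R :=
  sup [set dist_to x F | x in E] + sup [set dist_to y E | y in F].

Lemma mdist_circle_le2 x y : mdist x y <= 2.
Proof.
have n1 (z : circle R) : Normc.normc (val z) = 1.
  case: z => z /= /eqP; rewrite normc_def => /(congr1 (@complex.Re R)) /= <-.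
  by case: z.
rewrite mdist_circle.
have := le_normcD (val x : Rcomplex R) (- val y : Rcomplex R).
by rewrite (normcN (_ : Rcomplex R)) !n1; lra.
Qed.

Let lb x F : has_lbound [set mdist x y | y in F].
Proof. by exists 0 => _ [y _ <-]; exact: mdist_ge0. Qed.

Lemma dist_to_le x y F : F y -> dist_to x F <= mdist x y.
Proof. by move=> Fy; apply: ge_inf; [exact: lb|exists y]. Qed.

Lemma dist_to_ge0 x F : F !=set0 -> 0 <= dist_to x F.
Proof.
move=> [y Fy]; apply: lb_le_inf; first by exists (mdist x y), y.
by move=> _ [z _ <-]; exact: mdist_ge0.
Qed.

Lemma dist_to_triangle x y F : F !=set0 ->
  dist_to x F <= mdist x y + dist_to y F.
Proof.
move=> [z0 Fz0]; rewrite -lerBlDl; apply: lb_le_inf.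
  by exists (mdist y z0), z0.
move=> _ [z Fz <-]; rewrite lerBlDl.
by apply: le_trans (metric_triangle x y z); exact: dist_to_le.
Qed.

Let ub E F : F !=set0 -> has_ubound [set dist_to x F | x in E].
Proof.
move=> [y Fy]; exists 2 => _ [x _ <-].
exact: le_trans (dist_to_le x Fy) (mdist_circle_le2 _ _).
Qed.

Let excess_ge x E F : F !=set0 -> E x ->
  dist_to x F <= sup [set dist_to x F | x in E].
Proof. by move=> F0 Ex; apply: ub_le_sup; [exact: ub|exists x]. Qed.

Let excess_triangle E F G : E !=set0 -> F !=set0 -> G !=set0 ->
  sup [set dist_to x G | x in E] <=
  sup [set dist_to x F | x in E] + sup [set dist_to y G | y in F].
Proof.
move=> [x0 Ex0] F0 G0; apply: ge_sup; first by exists (dist_to x0 G), x0.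
move=> _ [x Ex <-].
apply: (@le_trans _ _ (dist_to x F + sup [set dist_to y G | y in F])).
  rewrite -lerBlDr; apply: lb_le_inf.
    by case: F0 => y Fy; exists (mdist x y), y.
  move=> _ [y Fy <-]; rewrite lerBlDr.
  apply: le_trans (dist_to_triangle x y G0) _.
  by rewrite lerD2l; exact: excess_ge.
by rewrite lerD2r; exact: excess_ge.
Qed.

Lemma hdist_sym E F : hdist E F = hdist F E.
Proof. by rewrite /hdist addrC. Qed.

Lemma hdist_triangle E F G : E !=set0 -> F !=set0 -> G !=set0 ->
  hdist E G <= hdist E F + hdist F G.
Proof.
move=> E0 F0 G0; rewrite /hdist.
have := excess_triangle E0 F0 G0; have := excess_triangle G0 F0 E0.
lra.
Qed.

Lemma hdistxx E : E !=set0 -> hdist E E = 0.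
Proof.
move=> E0; rewrite /hdist; have -> : [set dist_to x E | x in E] = [set 0].
  apply/seteqP; split => [_ [x Ex <-]|_ ->] /=.
    apply/eqP; rewrite eq_le dist_to_ge0// andbT.
    by apply: le_trans (dist_to_le x Ex) _; rewrite mdistxx.
  case: E0 => x Ex; exists x => //.
  apply/eqP; rewrite eq_le dist_to_ge0//; last by exists x.
  by rewrite andbT; apply: le_trans (dist_to_le x Ex) _; rewrite mdistxx.
by rewrite sup1 addr0.
Qed.

End HausdorffDistance.

(* A distribution S on the circle enters l^2(w) only through its Fourier
   coefficients, so the space and its norm are given on coefficient sequences
   int -> R[i]; they are only ever applied to coefficients of finite measures
   and to differences of such. *)
Section Ell2.
Context {R : realType}.
Variable w : nat -> {posnum R}.
Implicit Types a b c : int -> R[i].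

Definition ell2_sqnorm a : \bar R :=
  \esum_(n in [set: int]) (Normc.normc (a n) ^+ 2 * (w `|n|)%:num)%:E.

Definition ell2 : set (int -> R[i]) := [set a | (ell2_sqnorm a < +oo)%E].

Definition ell2_norm a : R := Num.sqrt (fine (ell2_sqnorm a)).

Let term_ge0 a n : (0 <= (Normc.normc (a n) ^+ 2 * (w `|n|)%:num)%:E)%E.
Proof. by rewrite lee_fin mulr_ge0// sqr_ge0. Qed.

Lemma ell2_sqnorm_ge0 a : (0 <= ell2_sqnorm a)%E.
Proof. by apply: esum_ge0 => n _; exact: term_ge0. Qed.

Lemma ell2_norm0 : ell2_norm (fun=> 0) = 0.
Proof.
rewrite /ell2_norm /ell2_sqnorm esum1; first by rewrite sqrtr0.
by move=> n _; rewrite (Normc.normc0 R) expr0n/= mul0r.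
Qed.

Lemma ell2_sqnorm_sym a b :
  ell2_sqnorm (fun n => a n - b n) = ell2_sqnorm (fun n => b n - a n).
Proof.
by apply: eq_esum => n _; rewrite -opprB (normcN (_ : Rcomplex R)).
Qed.

Lemma ell2_sqnormD_le a b (s t : R) : 0 < s -> 0 < t ->
  (ell2_sqnorm a <= (s ^+ 2)%:E)%E -> (ell2_sqnorm b <= (t ^+ 2)%:E)%E ->
  (ell2_sqnorm (fun n => a n + b n)%R <= ((s + t) ^+ 2)%:E)%E.
Proof.
move=> s0 t0 sa tb.
have fin_le c u (F : set int) : finite_set F ->
    (ell2_sqnorm c <= u%:E)%E ->
    \sum_(n \in F) (Normc.normc (c n) ^+ 2 * (w `|n|)%:num) <= u.
  move=> Ffin cu; rewrite -lee_fin; apply: le_trans cu.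
  by rewrite -fsumEFin//; apply: ereal_sup_ubound; exists F.
apply: ge_ereal_sup => _ [F [Ffin _] <-].
rewrite fsumEFin// lee_fin.
apply: (@le_trans _ _
  ((1 + t / s) * \sum_(n \in F) (Normc.normc (a n) ^+ 2 * (w `|n|)%:num) +
   (1 + s / t) * \sum_(n \in F) (Normc.normc (b n) ^+ 2 * (w `|n|)%:num))).
  rewrite !fsbig_finite//= !mulr_sumr -big_split/=; apply: ler_sum => n _.
  have := le_normcD (a n : Rcomplex R) (b n : Rcomplex R).
  have nge0 (z : R[i]) : 0 <= Normc.normc z by case: z => x y; exact: sqrtr_ge0.
  move: (nge0 (a n)) (nge0 (b n)) (nge0 (a n + b n)).
  set x := Normc.normc (a n); set y := Normc.normc (b n) => x0 y0.
  set z := Normc.normc _ => z0.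
  change (z <= x + y -> z ^+ 2 * (w `|n|)%:num <=
    (1 + t / s) * (x ^+ 2 * (w `|n|)%:num) +
    (1 + s / t) * (y ^+ 2 * (w `|n|)%:num)) => zxy.
  rewrite (mulrA (1 + t / s)) (mulrA (1 + s / t)) -mulrDl ler_wpM2r//.
  apply: (@le_trans _ _ ((x + y) ^+ 2)); first by rewrite ler_sqr ?nnegrE ?addr_ge0.
  rewrite -subr_ge0.
  have -> : (1 + t / s) * x ^+ 2 + (1 + s / t) * y ^+ 2 - (x + y) ^+ 2
      = (t * x - s * y) ^+ 2 / (s * t).
    by field; rewrite !gt_eqF.
  by rewrite divr_ge0 ?sqr_ge0// ltW// mulr_gt0.
have -> : (s + t) ^+ 2 = (1 + t / s) * s ^+ 2 + (1 + s / t) * t ^+ 2.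
  by field; rewrite !gt_eqF.
have st0 (u v : R) : 0 < u -> 0 < v -> 0 <= 1 + u / v.
  by move=> u0 v0; rewrite addr_ge0// divr_ge0// ltW.
by apply: lerD; apply: ler_wpM2l; [exact: st0|exact: fin_le|
                                  exact: st0|exact: fin_le].
Qed.

Let sqnorm_le a (s : R) : ell2 a -> ell2_norm a < s ->
  0 < s /\ (ell2_sqnorm a <= (s ^+ 2)%:E)%E.
Proof.
move=> la; rewrite /ell2_norm => las.
have s0 : 0 < s by apply: le_lt_trans las; exact: sqrtr_ge0.
have fa : ell2_sqnorm a \is a fin_num by rewrite ge0_fin_numE// ell2_sqnorm_ge0.
split => //; rewrite -(fineK fa) lee_fin -(@sqr_sqrtr _ (fine _)).
  by rewrite ler_sqr ?nnegrE ?sqrtr_ge0 ?(ltW las) ?(ltW s0).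
exact/fine_ge0/ell2_sqnorm_ge0.
Qed.

Lemma ell2D a b : ell2 a -> ell2 b -> ell2 (fun n => a n + b n).
Proof.
move=> la lb.
have [|s0 sa] := @sqnorm_le a (ell2_norm a + 1) la; first by rewrite ltrDl.
have [|t0 tb] := @sqnorm_le b (ell2_norm b + 1) lb; first by rewrite ltrDl.
by apply: le_lt_trans (ell2_sqnormD_le s0 t0 sa tb) _; rewrite ltey.
Qed.

Lemma ell2_normD a b : ell2 a -> ell2 b ->
  ell2_norm (fun n => a n + b n) <= ell2_norm a + ell2_norm b.
Proof.
move=> la lb; apply/ler_addgt0Pl => e e0.
have [|s0 sa] := @sqnorm_le a (ell2_norm a + e / 2) la.
  by rewrite ltrDl divr_gt0.
have [|t0 tb] := @sqnorm_le b (ell2_norm b + e / 2) lb.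
  by rewrite ltrDl divr_gt0.
have -> : e + (ell2_norm a + ell2_norm b) =
   (ell2_norm a + e / 2) + (ell2_norm b + e / 2) by field.
have st0 := ltW (addr_gt0 s0 t0).
rewrite {1}/ell2_norm -[leRHS](ger0_norm st0) -sqrtr_sqr.
apply: ler_wsqrtr; rewrite -lee_fin fineK; first exact: ell2_sqnormD_le.
by rewrite ge0_fin_numE ?ell2_sqnorm_ge0//; exact: ell2D.
Qed.

Lemma ell2N a : ell2 a -> ell2 (fun n => - a n).
Proof.
rewrite /ell2/= /ell2_sqnorm.
by under eq_esum do rewrite -(normcN (_ : Rcomplex R)).
Qed.

End Ell2.

Section CircleMeasure.
Context {R : realType}.

(* n-th coefficient: the integral of z ^ (- n), taken componentwise. *)
Definition fourier (mu : {measure set (circle R) -> \bar R}) (n : int) : R[i] :=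
  (\int[mu]_z complex.Re (val z ^ (- n))) +i* (\int[mu]_z complex.Im (val z ^ (- n))).

Definition measure_support (mu : {measure set (circle R) -> \bar R}) :
    set (circle R) :=
  [set z | forall U, open U -> U z -> (0 < mu U)%E].

End CircleMeasure.

(* A library measure is a function on all sets, with no constraint on the
   non-measurable ones; pair_measure_borel fixes these irrelevant values so that
   each Borel measure is represented by exactly one record.  The zero measure is
   allowed. *)
Record measure_pair (R : realType) (w : nat -> {posnum R}) := MeasurePair {
  pair_measure : {finite_measure set (circle R) -> \bar R} ;
  pair_set : set (circle R) ;
  pair_measure_borel : forall A, ~ measurable A -> pair_measure A = 0%E ;
  pair_measure_ell2 : ell2 w (fourier pair_measure) ;
  pair_set_nonempty : pair_set !=set0 ;
  pair_set_compact : compact pair_set ;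
  pair_support : measure_support pair_measure `<=` pair_set }.

Section PairMetric.
Context {R : realType} {w : nat -> {posnum R}}.
Implicit Types p q r : measure_pair w.

(* Installed below as the balls of a pseudoMetricType: closure and interior, hence
   genericity, only depend on the balls. *)
Definition pair_dist p q : R := hdist (pair_set p) (pair_set q) +
  ell2_norm w (fun n => fourier (pair_measure p) n - fourier (pair_measure q) n).

HB.instance Definition _ := gen_eqMixin (measure_pair w).
HB.instance Definition _ := gen_choiceMixin (measure_pair w).

Lemma pair_distxx p : pair_dist p p = 0.
Proof.
rewrite /pair_dist hdistxx; last exact: pair_set_nonempty.
by under eq_fun do rewrite subrr; rewrite ell2_norm0 addr0.
Qed.

Lemma pair_dist_sym p q : pair_dist p q = pair_dist q p.
Proof. by rewrite /pair_dist hdist_sym /ell2_norm ell2_sqnorm_sym. Qed.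

Lemma pair_dist_triangle q p r :
  pair_dist p r <= pair_dist p q + pair_dist q r.
Proof.
rewrite /pair_dist.
have h := hdist_triangle (pair_set_nonempty p) (pair_set_nonempty q)
  (pair_set_nonempty r).
pose f p := fourier (pair_measure p).
have lB p' q' : ell2 w (fun n => f p' n - f q' n).
  by apply: ell2D; [exact: pair_measure_ell2|exact/ell2N/pair_measure_ell2].
have := ell2_normD (lB p q) (lB q r).
under eq_fun do rewrite addrA subrK.
rewrite /f; lra.
Qed.

Let ball p (e : R) : set (measure_pair w) := [set q | pair_dist p q < e].

Let ball_center p (e : R) : 0 < e -> ball p e p.
Proof. by rewrite /ball/= pair_distxx. Qed.

Let ball_sym p q (e : R) : ball p e q -> ball q e p.
Proof. by rewrite /ball/= pair_dist_sym. Qed.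

Let ball_triangle p q r (d e : R) : ball p d q -> ball q e r ->
  ball p (d + e) r.
Proof.
by rewrite /ball/= => ? ?; rewrite (le_lt_trans (pair_dist_triangle q _ _))// ltrD.
Qed.

HB.instance Definition _ :=
  hasNbhs.Build (measure_pair w) (nbhs_ (entourage_ ball)).
HB.instance Definition _ := @Nbhs_isPseudoMetric.Build R (measure_pair w)
  (entourage_ ball) erefl ball ball_center ball_sym ball_triangle erefl.

End PairMetric.

(* Main.v *)
(* For each k, the pairs (sigma, E) with m (supp sigma) >= 1 / (k + 1) form a
   nowhere dense set: every pair can be approximated by a pair (tau, F) with F
   contained in N short arcs centred at the N-th roots of unity, of total length
   at most eta, and any F' close to F in the Hausdorff metric is contained in
   slightly longer arcs.

   To find tau, first convolve sigma with a smooth positive kernel Phi supported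
   near 1: this moves sigma little in l^2(w), moves the support little, and gives
   a density f whose Fourier coefficients decay fast. Then multiply f by
   Psi (z ^ N), where Psi is another smooth positive kernel of mean 1 supported
   near 1. The coefficients of f (z) (Psi (z ^ N) - 1) are a sum over k <> 0 of the
   coefficients of f shifted by k N, and the hypotheses on w provide arbitrarily
   large N for which w n <= eps (1 + |n - k N|)^A (1 + k)^A for all n and all
   k >= 1. As f and Psi are smooth enough to absorb these powers, the norm of the
   difference is O (sqrt eps).

   The kernels are cosine series. The first one is a triangle, obtained as a
   second difference of the expansion of t (1 - t), which is proved with the
   Dirichlet kernel and Bessel's inequality; repeated convolution makes the
   coefficients decay as fast as needed. *)

Require Import Defs.
From HB Require Import structures.
From mathcomp Require Import all_boot all_order all_algebra finmap.
From mathcomp Require Import complex.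
From mathcomp Require Import all_classical all_reals all_analysis.
From mathcomp Require Import measurable_realfun ring lra zify.

Set Implicit Arguments.
Unset Strict Implicit.
Unset Printing Implicit Defensive.

Import Order.TTheory GRing.Theory Num.Theory.
Import numFieldNormedType.Exports.

Local Open Scope classical_set_scope.
Local Open Scope ring_scope.

(** * Integrals of bounded measurable functions *)

(** The set E carried by a pair is what makes nowhere density possible. The norm alone does not
    control supports: adding a tiny multiple of arc length to a measure is a small change in l^2(w)
    that fills the circle. But a pair close to (tau, F) has its support inside a set that is
    Hausdorff close to F.

    Smoothing has to precede modulation. Multiplying by Psi (z ^ N) shifts frequencies, and shifts
    of a general sequence in l^2(w) are not controlled by w. After convolution the coefficients
    decay at a rate fixed beforehand, with constants that depend on sigma and on the kernels but not
    on N, so N can be chosen last.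

    The liminf makes w small only along a sequence. Regularity spreads this smallness around all
    multiples of one N, at a polynomial price. In the doubling case the degree A of this price
    depends on C, which is why kernels of every finite order are needed. Convolution provides them
    by algebra alone: coefficients multiply and widths add. *)

Lemma cvg_norm_le {R : realType} (x : R^nat) (l S : R) :
  x @ \oo --> l -> (forall n, `|x n| <= S) -> `|l| <= S.
Proof.
move=> xl xS; have nl : (fun n => `|x n|) @ \oo --> `|l| by exact: cvg_norm.
rewrite -(cvg_lim _ nl)//; apply: limr_le; first by apply/cvg_ex; exists `|l|.
exact: nearW.
Qed.

Section BoundedMeasurable.
Context {d} {T : measurableType d} {R : realType}.
Implicit Types (D : set T) (f g : T -> R).

(** Unlike integrability this is stable under products, and it implies integrability on sets of
    finite measure, so integrability conditions follow from the shape of the integrand. *)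
Definition bounded_measurable D f :=
  measurable_fun D f /\ exists B, forall x, D x -> `|f x| <= B.

Lemma bounded_measurable_cst D (r : R) : bounded_measurable D (fun=> r).
Proof. by split => //; exists `|r|. Qed.

Lemma bounded_measurableD D f g : bounded_measurable D f ->
  bounded_measurable D g -> bounded_measurable D (fun x => f x + g x).
Proof.
move=> [mf [B fB]] [mg [C gC]]; split; first exact: measurable_funD.
by exists (B + C) => x Dx; rewrite (le_trans (ler_normD _ _))// lerD ?fB ?gC.
Qed.

Lemma bounded_measurableM D f g : bounded_measurable D f ->
  bounded_measurable D g -> bounded_measurable D (fun x => f x * g x).
Proof.
move=> [mf [B fB]] [mg [C gC]]; split; first exact: measurable_funM.
by exists (B * C) => x Dx; rewrite normrM ler_pM ?fB ?gC.
Qed.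

Lemma bounded_measurableN D f : bounded_measurable D f ->
  bounded_measurable D (fun x => - f x).
Proof.
move=> bf; under eq_fun do rewrite -mulN1r.
by apply: bounded_measurableM => //; exact: bounded_measurable_cst.
Qed.

Lemma bounded_measurableB D f g : bounded_measurable D f ->
  bounded_measurable D g -> bounded_measurable D (fun x => f x - g x).
Proof. by move=> bf bg; apply/bounded_measurableD/bounded_measurableN. Qed.

Lemma bounded_measurable_sum D (F : nat -> T -> R) n :
  (forall i, bounded_measurable D (F i)) ->
  bounded_measurable D (fun x => \sum_(0 <= i < n) F i x).
Proof.
move=> bF; elim: n => [|n IH].
  by under eq_fun do rewrite big_geq//; exact: bounded_measurable_cst.
by under eq_fun do rewrite big_nat_recr//=; exact: bounded_measurableD.
Qed.

Lemma bounded_measurable_norm D f : bounded_measurable D f ->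
  bounded_measurable D (fun x => `|f x|).
Proof.
move=> [mf [B fB]]; split; first exact: measurableT_comp.
by exists B => x Dx; rewrite normr_id fB.
Qed.

Section Integral.
Variables (mu : {measure set T -> \bar R}) (D : set T).
Hypotheses (mD : measurable D) (finD : (mu D < +oo)%E).

Lemma bounded_measurable_integrable f : bounded_measurable D f ->
  mu.-integrable D (EFin \o f).
Proof.
move=> [mf [B fB]]; apply: (@le_integrable _ _ _ _ _ _ _ (EFin \o cst B)) => //.
- exact/measurable_EFinP.
- by move=> x Dx; rewrite /= lee_fin (le_trans (fB x Dx)) ?ler_norm.
- apply/integrableP; split; first by apply/measurable_EFinP.
  by rewrite /comp/= integral_cst//= lte_mul_pinfty ?lee_fin.
Qed.

Lemma bm_RintegralD f g : bounded_measurable D f -> bounded_measurable D g ->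
  \int[mu]_(x in D) (f x + g x) = \int[mu]_(x in D) f x + \int[mu]_(x in D) g x.
Proof. by move=> bf bg; rewrite RintegralD//; exact: bounded_measurable_integrable. Qed.

Lemma bm_RintegralB f g : bounded_measurable D f -> bounded_measurable D g ->
  \int[mu]_(x in D) (f x - g x) = \int[mu]_(x in D) f x - \int[mu]_(x in D) g x.
Proof. by move=> bf bg; rewrite RintegralB//; exact: bounded_measurable_integrable. Qed.

Lemma bm_RintegralZl (r : R) f : bounded_measurable D f ->
  \int[mu]_(x in D) (r * f x) = r * \int[mu]_(x in D) f x.
Proof. by move=> bf; rewrite RintegralZl//; exact: bounded_measurable_integrable. Qed.

Lemma bm_RintegralN f : bounded_measurable D f ->
  \int[mu]_(x in D) (- f x) = - \int[mu]_(x in D) f x.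
Proof.
by move=> bf; under eq_Rintegral do rewrite -mulN1r; rewrite bm_RintegralZl// mulN1r.
Qed.

Lemma bm_le_Rintegral f g : bounded_measurable D f -> bounded_measurable D g ->
  (forall x, D x -> f x <= g x) ->
  \int[mu]_(x in D) f x <= \int[mu]_(x in D) g x.
Proof. by move=> bf bg fg; apply: le_Rintegral => //;
  exact: bounded_measurable_integrable. Qed.

Lemma bm_normr_Rintegral f : bounded_measurable D f ->
  `|\int[mu]_(x in D) f x| <= \int[mu]_(x in D) `|f x|.
Proof. by move=> bf; apply: le_normr_Rintegral => //;
  exact: bounded_measurable_integrable. Qed.

Lemma normr_Rintegral_le (B : R) f : bounded_measurable D f ->
  (forall x, D x -> `|f x| <= B) ->
  `|\int[mu]_(x in D) f x| <= B * fine (mu D).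
Proof.
move=> bf fB; apply: le_trans (bm_normr_Rintegral bf) _.
rewrite -(Rintegral_cst mu mD); apply: bm_le_Rintegral => //.
  exact: bounded_measurable_norm.
exact: bounded_measurable_cst.
Qed.

Lemma bm_Rintegral_sum (F : nat -> T -> R) n :
  (forall i, bounded_measurable D (F i)) ->
  \int[mu]_(x in D) (\sum_(0 <= i < n) F i x) =
  \sum_(0 <= i < n) \int[mu]_(x in D) F i x.
Proof.
move=> bF; elim: n => [|n IH].
  rewrite big_geq//; under eq_Rintegral do rewrite big_geq//.
  by rewrite Rintegral_cst// mul0r.
under eq_Rintegral do rewrite big_nat_recr//=.
by rewrite bm_RintegralD ?IH ?big_nat_recr//; exact: bounded_measurable_sum.
Qed.

End Integral.

Section SeriesSection.
Variables (mu : {measure set T -> \bar R}) (D : set T).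
Hypotheses (mD : measurable D) (finD : (mu D < +oo)%E).
Variables (a : nat -> R) (u : nat -> T -> R) (g : T -> R) (S : R).
Hypothesis aS : forall n, \sum_(0 <= i < n) `|a i| <= S.
Hypothesis mu_ : forall i, measurable_fun D (u i).
Hypothesis u1 : forall i x, D x -> `|u i x| <= 1.
Hypothesis ug : forall x, D x ->
  (fun n => \sum_(0 <= i < n) a i * u i x) @ \oo --> g x.

Let bu i : bounded_measurable D (u i).
Proof. by split; [exact: mu_|exists 1; exact: u1]. Qed.

Let partial_le n x : D x -> `|\sum_(0 <= i < n) a i * u i x| <= S.
Proof.
move=> Dx; apply: le_trans (aS n); apply: le_trans (ler_norm_sum _ _ _) _.
by apply: ler_sum => i _; rewrite normrM ler_piMr// u1.
Qed.

Lemma normr_series_le x : D x -> `|g x| <= S.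
Proof.
by move=> Dx; apply: cvg_norm_le (ug Dx) _ => n; exact: partial_le.
Qed.

Lemma bounded_measurable_series : bounded_measurable D g.
Proof.
split; last by exists S; exact: normr_series_le.
apply: (@measurable_fun_cvg _ _ _ D
  (fun n x => \sum_(0 <= i < n) a i * u i x)) => // n.
have [] // := @bounded_measurable_sum D (fun i x => a i * u i x) n.
by move=> i; apply: bounded_measurableM => //; exact: bounded_measurable_cst.
Qed.

(** Dominated convergence with the constant bound [S * B]. The functions [u i] are abstract because
    they will be cosines of [t], of [x - s], of [N t] and of [t - circle_arg y], and also normalised
    harmonics. *)
Lemma cvg_Rintegral_series v : bounded_measurable D v ->
  (fun n => \sum_(0 <= i < n) a i * \int[mu]_(x in D) (u i x * v x)) @ \oo -->
  \int[mu]_(x in D) (g x * v x).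
Proof.
move=> bv; have [mv [B vB]] := bv.
have bau i : bounded_measurable D (fun x => a i * u i x).
  by apply: bounded_measurableM => //; exact: bounded_measurable_cst.
pose F n x := (\sum_(0 <= i < n) a i * u i x) * v x.
have bF n : bounded_measurable D (F n).
  by apply: bounded_measurableM => //; exact: bounded_measurable_sum.
have -> : (fun n => \sum_(0 <= i < n) a i * \int[mu]_(x in D) (u i x * v x)) =
    (fun n => \int[mu]_(x in D) F n x).
  apply/funext => n; rewrite /F.
  under [RHS]eq_Rintegral do rewrite mulr_suml.
  rewrite (@bm_Rintegral_sum mu D mD finD (fun i x => a i * u i x * v x)).
    apply: eq_bigr => i _; under [RHS]eq_Rintegral do rewrite -mulrA.
    by rewrite bm_RintegralZl//; exact: bounded_measurableM.
  by move=> i; exact: bounded_measurableM.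
have bgv : bounded_measurable D (fun x => g x * v x).
  by apply: bounded_measurableM => //; exact: bounded_measurable_series.
have [] := @dominated_convergence _ _ _ mu _ mD (fun n x => (F n x)%:E)
  (fun x => (g x * v x)%:E) (cst (S * B)%:E).
- by move=> n; apply/measurable_EFinP; case: (bF n).
- by apply/measurable_EFinP; case: bgv.
- apply: aeW => x Dx; apply: cvg_EFin; first exact: nearW.
  by apply: cvgM; [exact: ug|exact: cvg_cst].
- by apply: (@bounded_measurable_integrable mu D mD finD (cst _));
  exact: bounded_measurable_cst.
- apply: aeW => x n Dx; rewrite lee_fin normrM.
  by apply: ler_pM => //; [exact: partial_le|exact: vB].
move=> _ _ h; rewrite /Rintegral.
apply: fine_cvg; rewrite fineK//.
by apply: integrable_fin_num => //; exact: bounded_measurable_integrable.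
Qed.

End SeriesSection.
End BoundedMeasurable.

(** * Trigonometric inequalities *)

Section Trigonometry.
Context {R : realType}.
Implicit Types (t x y a b : R) (m n : nat).

Lemma is_derive_affine a b t : is_derive t 1 (fun u => a * u + b) a.
Proof.
have -> : (fun u => a * u + b) = (a \*: (id : R -> R)) + cst b by apply/funext.
by apply: is_derive_eq; rewrite addr0 /GRing.scale/= mulr1.
Qed.

Lemma is_derive_sin_affine a b t :
  is_derive t 1 (fun u => sin (a * u + b)) (a * cos (a * t + b)).
Proof.
by rewrite mulrC; apply: (is_derive1_comp (f := sin)); exact: is_derive_affine.
Qed.

Lemma is_derive_cos_affine a b t :
  is_derive t 1 (fun u => cos (a * u + b)) (- (a * sin (a * t + b))).
Proof.
rewrite mulrC -mulNr.
by apply: (is_derive1_comp (f := cos)); exact: is_derive_affine.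
Qed.

Lemma continuous_affine a b : continuous (fun u : R => a * u + b).
Proof.
by move=> t; apply: cvgD; [apply: cvgM; [exact: cvg_cst|exact: cvg_id]|exact: cvg_cst].
Qed.

Lemma continuous_cos_affine a b : continuous (fun u : R => cos (a * u + b)).
Proof.
move=> t; apply: (@continuous_comp _ _ _ (fun u => a * u + b) cos).
  exact: continuous_affine.
exact: continuous_cos.
Qed.

Lemma continuous_sin_affine a b : continuous (fun u : R => sin (a * u + b)).
Proof.
move=> t; apply: (@continuous_comp _ _ _ (fun u => a * u + b) sin).
  exact: continuous_affine.
exact: continuous_sin.
Qed.

Lemma bounded_measurable_cos_affine (D : set R) a b :
  bounded_measurable D (fun u => cos (a * u + b)).
Proof.
split; last by exists 1 => t _; exact: cos_max.
apply: measurable_funTS; apply: continuous_measurable_fun.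
exact: continuous_cos_affine.
Qed.

Lemma bounded_measurable_sin_affine (D : set R) a b :
  bounded_measurable D (fun u => sin (a * u + b)).
Proof.
split; last by exists 1 => t _; exact: sin_max.
apply: measurable_funTS; apply: continuous_measurable_fun.
exact: continuous_sin_affine.
Qed.

Lemma bounded_measurable_cos_mul (D : set R) a :
  bounded_measurable D (fun u => cos (a * u)).
Proof.
have -> : (fun u => cos (a * u)) = (fun u => cos (a * u + 0)).
  by apply/funext => u; rewrite addr0.
exact: bounded_measurable_cos_affine.
Qed.

Lemma bounded_measurable_sin_mul (D : set R) a :
  bounded_measurable D (fun u => sin (a * u)).
Proof.
have -> : (fun u => sin (a * u)) = (fun u => sin (a * u + 0)).
  by apply/funext => u; rewrite addr0.
exact: bounded_measurable_sin_affine.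
Qed.

Lemma sinD2pin x n : sin (x + 2 * pi * n%:R) = sin x.
Proof.
by rewrite mulr_natr mulr_natl (periodicn (@sinD2pi R)).
Qed.

Lemma cosD2pin x n : cos (x + 2 * pi * n%:R) = cos x.
Proof.
by rewrite mulr_natr mulr_natl (periodicn (@cosD2pi R)).
Qed.

Lemma norm_sinDpin x n : `|sin (x + pi * n%:R)| = `|sin x|.
Proof.
by rewrite mulr_natr (alternatingn (@sinDpi R)) normrM normrX normrN normr1 expr1n mul1r.
Qed.

Lemma odd_natr n : n.*2.+1%:R = 2 * n%:R + 1 :> R.
Proof. by rewrite -natr1 -mul2n natrM. Qed.

Lemma cosM_sum x y : cos x * cos y = (cos (x - y) + cos (x + y)) / 2.
Proof. by rewrite cosB cosD; field. Qed.

Lemma sinM_sum x y : sin x * sin y = (cos (x - y) - cos (x + y)) / 2.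
Proof. by rewrite cosB cosD; field. Qed.

Lemma sincosM_sum x y : sin x * cos y = (sin (x + y) + sin (x - y)) / 2.
Proof. by rewrite sinB sinD; field. Qed.

Lemma cos_double x : 1 - cos (2 * x) = 2 * sin x ^+ 2.
Proof. by rewrite mulr_natl cos_mulr2n sin2cos2; ring. Qed.

(** With [norm_sinD_le], this lets [|sin (pi t)|] serve as a distance from [t] to the integers
    without any reduction modulo 1. *)
Lemma sin_natM_le n x : `|sin (n%:R * x)| <= n%:R * `|sin x|.
Proof.
elim: n => [|n IH]; first by rewrite !mul0r sin0 normr0.
rewrite -natr1 !mulrDl !mul1r sinD (le_trans (ler_normD _ _))// lerD// normrM.
  by rewrite (le_trans _ IH)// ler_piMr ?cos_max.
by rewrite ler_piMl ?cos_max.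
Qed.

Lemma norm_sinD_le x y : `|sin (x + y)| <= `|sin x| + `|sin y|.
Proof.
rewrite sinD (le_trans (ler_normD _ _))// lerD// normrM.
  by rewrite ler_piMr ?cos_max.
by rewrite ler_piMl ?cos_max.
Qed.

Lemma norm_sin_le x : `|sin x| <= `|x|.
Proof.
wlog x0 : x / 0 <= x => [H|].
  have [/H//|/ltW x0] := leP 0 x.
  by rewrite -normrN -sinN -(normrN x) H// oppr_ge0.
have [|c _] := @MVT_segment R sin cos 0 x x0 (fun c _ => is_derive_sin c).
  by apply: continuous_subspaceT => c; exact: continuous_sin.
by rewrite sin0 !subr0 => ->; rewrite normrM ler_piMl// cos_max.
Qed.

(* sin (pi x) = 2 sin (pi x / 2) cos (pi x / 2) and both pi x / 2 and its
   intermediate point lie in [0, pi / 4], where cos is at least sqrt (1/2). *)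
Lemma sin_pi_ge x : 0 <= x <= 1 / 2 -> x <= sin (pi * x).
Proof.
move=> /andP[x0 x2].
have pi2 : 2 <= pi :> R := pi_ge2 R.
have c4 : 1 / 2 <= cos (pi / 4 : R) ^+ 2.
  have := cos_double (pi / 4 : R).
  have -> : 2 * (pi / 4) = pi / 2 :> R by field.
  by rewrite cos_pihalf sin2cos2; lra.
have cge y : 0 <= y <= pi / 4 -> cos (pi / 4 : R) <= cos y.
  move=> /andP[y0 y4]; rewrite leNgt; apply/negP => h.
  by move: h; rewrite ltr_cos ?in_itv/=; lra.
have c40 : 0 <= cos (pi / 4 : R) by apply: cos_ge0_pihalf; lra.
set y := pi * x / 2.
have y0 : 0 <= y by rewrite /y divr_ge0// mulr_ge0// pi_ge0.
have y4 : y <= pi / 4 by rewrite /y; nra.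
have [|c] := @MVT_segment R sin cos 0 y y0 (fun c _ => is_derive_sin c).
  by apply: continuous_subspaceT => c; exact: continuous_sin.
rewrite in_itv/= sin0 !subr0 => /andP[c0 cy] sy.
have -> : pi * x = y *+ 2 by rewrite /y -mulr_natr; field.
rewrite sin_mulr2n sy -mulr_natr.
have cc : 1 / 2 <= cos y * cos c.
  by rewrite (le_trans c4)// expr2 ler_pM// cge//; lra.
have xy : x <= y by rewrite /y; nra.
nra.
Qed.

(** The parabola controls the sine near both of its zeros at once. It is applied to [|t - x|] to
    bound a quotient whose denominator vanishes when this distance is 0 or 1. *)
Lemma sin_pi_ge_parabola x : 0 <= x <= 1 -> x * (1 - x) <= sin (pi * x).
Proof.
move=> /andP[x0 x1]; have [x2|/ltW x2] := leP x (1 / 2).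
  by apply: (@le_trans _ _ x); [nra|apply: sin_pi_ge; lra].
have -> : sin (pi * x) = sin (pi * (1 - x)).
  by rewrite mulrBr mulr1 addrC sinDpi sinN opprK.
by apply: (@le_trans _ _ (1 - x)); [nra|apply: sin_pi_ge; lra].
Qed.

End Trigonometry.

Ltac solve_bm := repeat first
  [ assumption | by auto | exact: bounded_measurable_cst
  | exact: bounded_measurable_cos_affine | exact: bounded_measurable_sin_affine
  | exact: bounded_measurable_cos_mul | exact: bounded_measurable_sin_mul
  | apply: bounded_measurableB | apply: bounded_measurableD
  | apply: bounded_measurableM | apply: bounded_measurableN
  | apply: bounded_measurable_sum => ? ].

(** * Fourier analysis on the unit interval *)

Section UnitInterval.
Context {R : realType}.
Implicit Types (t x y a b : R) (m n : nat) (f g h : R -> R).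
Local Notation mu := (@lebesgue_measure R).
Local Notation I01 := (`[0%R, 1%R]%classic : set R).
Local Notation bm := (bounded_measurable I01).

Lemma measurable01 : measurable (I01 : set (measurableTypeR R)).
Proof. exact: measurable_itv. Qed.

Lemma lebesgue01 : mu I01 = 1%E.
Proof. by rewrite lebesgue_measure_itv/= lte_fin ltr01 sube0. Qed.

Lemma lebesgue01_fin : (mu I01 < +oo)%E.
Proof. by rewrite lebesgue01 ltey. Qed.

Lemma Rintegral01_cst (r : R) : \int[mu]_(t in I01) r = r.
Proof. by rewrite (Rintegral_cst mu measurable01) [X in fine X]lebesgue01 mulr1. Qed.

Lemma Rintegral01B f g : bm f -> bm g ->
  \int[mu]_(t in I01) (f t - g t) = \int[mu]_(t in I01) f t - \int[mu]_(t in I01) g t.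
Proof.
by move=> *; rewrite bm_RintegralB//; exact: lebesgue01_fin.
Qed.

Lemma Rintegral01D f g : bm f -> bm g ->
  \int[mu]_(t in I01) (f t + g t) = \int[mu]_(t in I01) f t + \int[mu]_(t in I01) g t.
Proof.
by move=> *; rewrite bm_RintegralD//; exact: lebesgue01_fin.
Qed.

Lemma Rintegral01Zl (r : R) f : bm f ->
  \int[mu]_(t in I01) (r * f t) = r * \int[mu]_(t in I01) f t.
Proof.
by move=> *; rewrite bm_RintegralZl//; exact: lebesgue01_fin.
Qed.

Lemma Rintegral01_sum (F : nat -> R -> R) n : (forall i, bm (F i)) ->
  \int[mu]_(t in I01) (\sum_(0 <= i < n) F i t) =
  \sum_(0 <= i < n) \int[mu]_(t in I01) F i t.
Proof.
by move=> *; rewrite bm_Rintegral_sum//; exact: lebesgue01_fin.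
Qed.

Lemma le_Rintegral01 f g : bm f -> bm g -> (forall t, I01 t -> f t <= g t) ->
  \int[mu]_(t in I01) f t <= \int[mu]_(t in I01) g t.
Proof. exact: (bm_le_Rintegral measurable01 lebesgue01_fin). Qed.

Lemma normr_Rintegral01 f : bm f ->
  `|\int[mu]_(t in I01) f t| <= \int[mu]_(t in I01) `|f t|.
Proof. exact: (bm_normr_Rintegral measurable01 lebesgue01_fin). Qed.

Lemma bounded_measurable01_continuous f : continuous f -> bm f.
Proof.
move=> cf; split; first by apply: measurable_funTS; exact: continuous_measurable_fun.
have [|B [_ fB]] := @compact_bounded _ _ (f @` I01).
  apply: continuous_compact; last exact: segment_compact.
  exact: continuous_subspaceT.
exists (B + 1) => t It; apply: (fB (B + 1)); first by rewrite ltrDl.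
by exists t.
Qed.

Lemma Rintegral01_FTC f (F : R -> R) : continuous f ->
  (forall t, is_derive t 1 F (f t)) ->
  \int[mu]_(t in I01) f t = F 1 - F 0.
Proof.
move=> cf dF; rewrite /Rintegral (@continuous_FTC2 _ f F)//.
- exact: continuous_subspaceT.
- have cF : continuous F.
    by move=> t; apply: differentiable_continuous; apply/derivable1_diffP; case: (dF t).
  split; first by move=> t _; case: (dF t).
    by apply: cvg_at_right_filter; exact: cF.
  by apply: cvg_at_left_filter; exact: cF.
- by move=> t _; rewrite derive1E; case: (dF t).
Qed.

Lemma Rintegral01_cos m b : (0 < m)%N ->
  \int[mu]_(t in I01) cos (2 * pi * m%:R * t + b) = 0.
Proof.
move=> m0; have a0 : 2 * pi * m%:R != 0 :> R.
  by rewrite !mulf_neq0 ?gt_eqF ?pi_gt0 ?ltr0n.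
have d t : is_derive t 1
    (fun u => (2 * pi * m%:R)^-1 * sin (2 * pi * m%:R * u + b))
    (cos (2 * pi * m%:R * t + b)).
  have := is_deriveZ (2 * pi * m%:R)^-1 (is_derive_sin_affine (2 * pi * m%:R) b t).
  by move/is_derive_eq; apply; rewrite /GRing.scale/= mulKf.
rewrite (Rintegral01_FTC _ d); last exact: continuous_cos_affine.
by rewrite mulr1 mulr0 add0r addrC [2 * pi * m%:R + b]addrC sinD2pin addNr.
Qed.

Lemma Rintegral01_sin m b : (0 < m)%N ->
  \int[mu]_(t in I01) sin (2 * pi * m%:R * t + b) = 0.
Proof.
move=> m0; under eq_Rintegral do rewrite -cosBpihalf -addrA.
exact: Rintegral01_cos.
Qed.

Lemma Rintegral01_parabola : \int[mu]_(t in I01) (t * (1 - t)) = 6^-1.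
Proof.
have d t : is_derive t 1 (fun u : R => 2^-1 * u ^+ 2 + (- 3^-1) * u ^+ 3) (t * (1 - t)).
  have := is_deriveD (is_deriveZ 2^-1 (is_deriveX 2 (is_derive_id t 1)))
    (is_deriveZ (- 3^-1) (is_deriveX 3 (is_derive_id t 1))).
  by move/is_derive_eq; apply; rewrite /GRing.scale/=; field.
rewrite (Rintegral01_FTC _ d); first by rewrite !expr1n !expr0n/=; field.
move=> t; apply: cvgM; first exact: cvg_id.
by apply: cvgB; [exact: cvg_cst|exact: cvg_id].
Qed.

Lemma Rintegral01_parabola_cos m x : (0 < m)%N ->
  \int[mu]_(t in I01) (t * (1 - t) * cos (2 * pi * m%:R * (t - x))) =
  - cos (2 * pi * m%:R * x) / (2 * (pi * m%:R) ^+ 2).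
Proof.
move=> m0; set a := 2 * pi * m%:R; have a0 : a != 0.
  by rewrite !mulf_neq0 ?gt_eqF ?pi_gt0 ?ltr0n.
have E t : a * (t - x) = a * t + - (a * x) by rewrite mulrBr.
under eq_Rintegral do rewrite E.
set b := - (a * x).
pose P u : R := u * (1 - u).
pose P' u : R := 1 - 2 * u.
have dP t : is_derive t 1 P (P' t).
  have := is_deriveM (is_derive_id t 1) (is_deriveB (is_derive_cst (1 : R) t 1)
    (is_derive_id t 1)).
  by move/is_derive_eq; apply; rewrite /GRing.scale/= /P' !fctE /=; ring.
have dP' t : is_derive t 1 P' (- 2).
  have := is_deriveB (is_derive_cst (1 : R) t 1)
    (is_deriveZ 2 (is_derive_id t (1 : R))).
  by move/is_derive_eq; apply; rewrite /GRing.scale/=; ring.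
(* Two integrations by parts. Over a full period only the [P'] term survives, as [P] vanishes at
   both ends and the sine is periodic. *)
pose F u := a^-1 * (P u * sin (a * u + b)) + (a ^- 2 * (P' u * cos (a * u + b)) +
  2 * a ^- 3 * sin (a * u + b)).
have dF t : is_derive t 1 F (P t * cos (a * t + b)).
  have s := is_derive_sin_affine a b t; have c := is_derive_cos_affine a b t.
  have := is_deriveD (is_deriveZ a^-1 (is_deriveM (dP t) s))
    (is_deriveD (is_deriveZ (a ^- 2) (is_deriveM (dP' t) c))
      (is_deriveZ (2 * a ^- 3) s)).
  move/is_derive_eq; apply; rewrite /GRing.scale/=.
  by field.
rewrite (Rintegral01_FTC _ dF); last first.
  move=> t; apply: cvgM; last exact: continuous_cos_affine.
  apply: cvgM; first exact: cvg_id.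
  by apply: cvgB; [exact: cvg_cst|exact: cvg_id].
rewrite /F /P /P' !mulr0 mulr1 add0r subrr subr0 !mul0r !mulr0 !add0r.
rewrite (addrC a) {1 2}/a cosD2pin sinD2pin /b cosN mulr1.
have pi0 : pi != 0 :> R by rewrite gt_eqF ?pi_gt0.
have mn0 : m%:R != 0 :> R by rewrite gt_eqF ?ltr0n.
rewrite /a; set C := cos _; set S := sin _; clearbody C S.
by move: (pi : R) pi0 => p p0; field; rewrite mn0 p0.
Qed.

(** Numerator of the Dirichlet kernel centred at [x]. These functions are orthogonal on the unit
    interval because sums and differences of odd multiples of pi are multiples of 2 pi. *)
Definition half_sin x M t := sin (pi * (M.*2.+1)%:R * (t - x)).

Lemma bm_half_sin x M : bm (half_sin x M).
Proof.
have -> : half_sin x M = (fun t => sin (pi * (M.*2.+1)%:R * t + (- (pi * (M.*2.+1)%:R * x)))).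
  by apply/funext => t; rewrite /half_sin mulrBr.
exact: bounded_measurable_sin_affine.
Qed.

Lemma half_sin_orthogonal x M L : (M < L)%N ->
  \int[mu]_(t in I01) (half_sin x M t * half_sin x L t) = 0.
Proof.
move=> ML; have E t : half_sin x M t * half_sin x L t =
  2^-1 * cos (2 * pi * (L - M)%N%:R * t + (- (2 * pi * (L - M)%N%:R * x))) -
  2^-1 * cos (2 * pi * (L + M + 1)%N%:R * t + (- (2 * pi * (L + M + 1)%N%:R * x))).
  rewrite mulrC sinM_sum -!mulrBr -mulrBl -mulrDl -!mulrBr -mulrDr.
  rewrite (_ : pi * (L.*2.+1%:R - M.*2.+1%:R) = 2 * pi * (L - M)%N%:R); last first.
    by rewrite !odd_natr natrB ?(ltnW ML)//; ring.
  rewrite (_ : pi * (L.*2.+1%:R + M.*2.+1%:R) = 2 * pi * (L + M + 1)%N%:R); last first.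
    by rewrite !odd_natr !natrD; ring.
  by rewrite mulrC mulrBr.
under eq_Rintegral do rewrite E.
have bc := @bounded_measurable_cos_affine R I01.
rewrite Rintegral01B; [|by solve_bm..].
rewrite !Rintegral01Zl; [|by solve_bm..].
by rewrite !Rintegral01_cos ?mulr0 ?subrr ?subn_gt0 ?addn1.
Qed.

Lemma half_sin_norm x M :
  \int[mu]_(t in I01) (half_sin x M t * half_sin x M t) = 2^-1.
Proof.
have E t : half_sin x M t * half_sin x M t =
  2^-1 - 2^-1 * cos (2 * pi * (M + M + 1)%N%:R * t + (- (2 * pi * (M + M + 1)%N%:R * x))).
  rewrite sinM_sum subrr cos0 -mulrDl -mulrDr -mulrBr.
  rewrite (_ : pi * (M.*2.+1%:R + M.*2.+1%:R) = 2 * pi * (M + M + 1)%N%:R); last first.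
    by rewrite !odd_natr !natrD; ring.
  by rewrite mulrBl mul1r [in RHS]mulrC.
under eq_Rintegral do rewrite E.
have bc := @bounded_measurable_cos_affine R I01.
rewrite Rintegral01B; [|by solve_bm..].
rewrite Rintegral01Zl; [|by solve_bm].
by rewrite Rintegral01_cst Rintegral01_cos ?mulr0 ?subr0 ?addn1.
Qed.

(* By Bessel's inequality, the half_sin x M being orthogonal in L^2(0, 1). *)
Lemma half_sin_coef_cvg0 x h : bm h ->
  (fun M => \int[mu]_(t in I01) (h t * half_sin x M t)) @ \oo --> (0 : R).
Proof.
move=> bh; set c := fun M => _.
have bs := bm_half_sin x.
(* The factor 2 is the inverse of the squared norm of [half_sin x M], so [r L] is the residual of an
   orthogonal projection. By [rr], each function removes [2 * c M ^+ 2] from its energy. *)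
pose r L t := h t - \sum_(0 <= M < L) 2 * c M * half_sin x M t.
have bcs M : bm (fun t => 2 * c M * half_sin x M t).
  by solve_bm.
have br L : bm (r L) by rewrite /r; solve_bm.
have rs L : \int[mu]_(t in I01) (r L t * half_sin x L t) = c L.
  have E t : r L t * half_sin x L t = h t * half_sin x L t -
      \sum_(0 <= M < L) 2 * c M * (half_sin x M t * half_sin x L t).
    rewrite /r mulrBl mulr_suml; congr (_ - _).
    by apply: eq_bigr => M _; rewrite mulrA.
  under eq_Rintegral do rewrite E.
  rewrite Rintegral01B; [|by solve_bm..].
  rewrite (Rintegral01_sum (F := fun M t => 2 * c M * (half_sin x M t * half_sin x L t))); last first.
    by move=> i; solve_bm.
  rewrite big_nat big1 ?subr0// => M /andP[_ ML].
  by rewrite Rintegral01Zl ?half_sin_orthogonal ?mulr0//; solve_bm.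
have rr L : \int[mu]_(t in I01) (r L t * r L t) =
    \int[mu]_(t in I01) (h t * h t) - \sum_(0 <= M < L) 2 * c M ^+ 2.
  elim: L => [|L IH].
    rewrite big_geq// subr0; apply: eq_Rintegral => t _.
    by rewrite /r big_geq// subr0.
  have E t : r L.+1 t * r L.+1 t =
    r L t * r L t + (- 4 * c L) * (r L t * half_sin x L t)
      + 4 * c L ^+ 2 * (half_sin x L t * half_sin x L t).
    by rewrite /r big_nat_recr//=; ring.
  under eq_Rintegral do rewrite E.
  rewrite Rintegral01D; [|by solve_bm..].
  rewrite Rintegral01D; [|by solve_bm..].
  rewrite !Rintegral01Zl; [|by solve_bm..].
  by rewrite rs half_sin_norm IH big_nat_recr//=; field.
have cvgc : cvgn (series (fun M => 2 * c M ^+ 2)).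
  apply: nondecreasing_is_cvgn.
    by apply: nondecreasing_series => M _ _; rewrite mulr_ge0// sqr_ge0.
  exists (\int[mu]_(t in I01) (h t * h t)) => _ [L _ <-].
  rewrite /series/= -subr_ge0 -rr; apply: Rintegral_ge0 => t _.
  by rewrite -expr2 sqr_ge0.
have := cvg_series_cvg_0 cvgc => c0.
have : (fun M => `|c M|) @ \oo --> (0 : R).
  have -> : (fun M => `|c M|) = (fun M => Num.sqrt (2^-1 * (2 * c M ^+ 2))).
    by apply/funext => M; rewrite mulKf// sqrtr_sqr.
  rewrite -[X in _ --> X]sqrtr0.
  have d0 : (fun M => 2^-1 * (2 * c M ^+ 2)) @ \oo --> (0 : R).
    by rewrite -[X in _ --> X](mulr0 2^-1); apply: cvgM => //; exact: cvg_cst.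
  exact: (cvg_comp _ _ d0 (@sqrt_continuous R 0)).
by move/norm_cvg0P.
Qed.

End UnitInterval.

(** * Cosine expansion of the parabola *)

Section ParabolaSeries.
Context {R : realType}.
Implicit Types (t x : R) (m n : nat).
Local Notation mu := (@lebesgue_measure R).
Local Notation I01 := (`[0%R, 1%R]%classic : set R).

Lemma measurable_inv : measurable_fun setT (@GRing.inv R).
Proof.
rewrite -(setUv [set 0 : R]); apply/measurable_funU => //.
  by apply: measurableC; exact: measurable_set1.
split; first exact: measurable_fun_set1.
apply: open_continuous_measurable_fun.
  by apply: closed_openC; exact: closed_eq.
by move=> x; rewrite inE/= => /eqP x0; exact: inv_continuous.
Qed.

Definition dirichlet_kernel n x : R := 1 + \sum_(0 <=
  m < n) 2 * cos (2 * pi * m.+1%:R * x).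

Lemma dirichlet_kernelE n x :
  dirichlet_kernel n x * sin (pi * x) = sin (pi * n.*2.+1%:R * x).
Proof.
elim: n => [|n IH]; first by rewrite /dirichlet_kernel big_geq// addr0 mul1r mulr1.
rewrite /dirichlet_kernel big_nat_recr//= addrA mulrDl IH !odd_natr -[n.+1%:R]natr1.
rewrite (_ : pi * (2 * (n%:R + 1) + 1) * x = 2 * pi * (n%:R + 1) * x + pi * x);
  last by ring.
rewrite (_ : pi * (2 * n%:R + 1) * x = 2 * pi * (n%:R + 1) * x - pi * x); last by ring.
by rewrite sinB sinD; ring.
Qed.

(** Its boundedness is what lets Bessel's inequality apply. At a zero of the sine its value is 0, by
    the convention on inverses. *)
Let parabola_quotient x t := (x * (1 - x) - t * (1 - t)) / sin (pi * (t - x)).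

Let bm_parabola_quotient x : 0 <= x <= 1 ->
  bounded_measurable I01 (parabola_quotient x).
Proof.
move=> /andP[x0 x1]; split.
  apply: measurable_funTS; apply: measurable_funM.
    apply: continuous_measurable_fun => t; apply: cvgB; first exact: cvg_cst.
    by apply: cvgM; [exact: cvg_id|apply: cvgB; [exact: cvg_cst|exact: cvg_id]].
  apply: (measurableT_comp measurable_inv); apply: continuous_measurable_fun.
  have -> : (fun t => sin (pi * (t - x))) = (fun t => sin (pi * t + (- (pi * x)))).
    by apply/funext => t; rewrite mulrBr.
  exact: continuous_sin_affine.
exists 1 => t; rewrite /= in_itv/= => /andP[t0 t1].
rewrite /parabola_quotient normrM normfV.
have [s0|s0] := eqVneq (sin (pi * (t - x))) 0; first by rewrite s0 normr0 invr0 mulr0.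
rewrite ler_pdivrMr ?normr_gt0// mul1r.
have -> : x * (1 - x) - t * (1 - t) = (t - x) * (t + x - 1) by ring.
have Hs : `|sin (pi * (t - x))| = `|sin (pi * `|t - x|)|.
  have [h|h] := leP 0 (t - x); first by rewrite (ger0_norm h).
  by rewrite (ltr0_norm h) mulrN sinN normrN.
(* On the unit square, [|t + x - 1| <= 1 - |t - x|]. *)
rewrite Hs; apply: (@le_trans _ _ (`|t - x| * (1 - `|t - x|))).
  rewrite normrM ler_wpM2l// ler_norml.
  by have [h|/ltW h] := leP 0 (t - x); [rewrite (ger0_norm h)|rewrite (ler0_norm h)]; lra.
apply: le_trans (ler_norm _); apply: sin_pi_ge_parabola.
by rewrite normr_ge0/= ler_norml; lra.
Qed.

(** Dirichlet's argument: the error of the n-th partial sum at [x] is the integral of the bounded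
    quotient against [half_sin x n], which tends to 0. *)
Lemma cvg_parabola_series x : 0 <= x <= 1 ->
  (fun n => \sum_(0 <= m < n)
    (pi * m.+1%:R) ^- 2 * cos (2 * pi * m.+1%:R * x)) @ \oo -->
  6^-1 - x * (1 - x).
Proof.
move=> x01; have bh := bm_parabola_quotient x01.
have bP : bounded_measurable I01 (fun t => t * (1 - t)).
  apply: bounded_measurable01_continuous => t.
  by apply: cvgM; [exact: cvg_id|apply: cvgB; [exact: cvg_cst|exact: cvg_id]].
have cE m t : cos (2 * pi * m.+1%:R * (t - x)) =
    cos (2 * pi * m.+1%:R * t + (- (2 * pi * m.+1%:R * x))) by rewrite mulrBr.
have bc m : bounded_measurable I01 (fun t => cos (2 * pi * m.+1%:R * (t - x))).
  by rewrite (funext (cE m)); solve_bm.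
have bD n : bounded_measurable I01 (fun t => dirichlet_kernel n (t - x)).
  by rewrite /dirichlet_kernel; solve_bm; exact: bc.
have ID n : \int[mu]_(t in I01) dirichlet_kernel n (t - x) = 1.
  rewrite Rintegral01D; [|by solve_bm|by solve_bm; exact: bc].
  rewrite Rintegral01_cst (Rintegral01_sum (F := fun m t => 2 * cos (2 * pi * m.+1%:R * (t - x)))).
    rewrite big1 ?addr0// => m _.
    rewrite Rintegral01Zl; last exact: bc.
    by under eq_Rintegral do rewrite cE; rewrite Rintegral01_cos// mulr0.
  by move=> m; solve_bm; exact: bc.
have IPD n : \int[mu]_(t in I01) (t * (1 - t) * dirichlet_kernel n (t - x)) =
    6^-1 - \sum_(0 <= m < n) (pi * m.+1%:R) ^- 2 * cos (2 * pi * m.+1%:R * x).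
  have E t : t * (1 - t) * dirichlet_kernel n (t - x) = t * (1 - t) +
      \sum_(0 <= m < n) 2 * (t * (1 - t) * cos (2 * pi * m.+1%:R * (t - x))).
    rewrite /dirichlet_kernel mulrDr mulr1 mulr_sumr; congr (_ + _).
    by apply: eq_bigr => m _; rewrite mulrCA.
  under eq_Rintegral do rewrite E.
  rewrite Rintegral01D//; last by solve_bm; exact: bc.
  rewrite Rintegral01_parabola (Rintegral01_sum
    (F := fun m t => 2 * (t * (1 - t) * cos (2 * pi * m.+1%:R * (t - x))))); last first.
    by move=> m; solve_bm; exact: bc.
  rewrite -sumrN; congr (_ + _); apply: eq_bigr => m _.
  rewrite Rintegral01Zl; last by solve_bm; exact: bc.
  rewrite Rintegral01_parabola_cos//.
  have p0 : (pi * m.+1%:R : R) != 0 by rewrite mulf_neq0 ?gt_eqF ?pi_gt0 ?ltr0n.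
  by set C := cos _; move: (pi * _) p0 => p p0; field.
have key n : \int[mu]_(t in I01) (parabola_quotient x t * half_sin x n t) =
    x * (1 - x) - 6^-1 + \sum_(0 <= m < n)
      (pi * m.+1%:R) ^- 2 * cos (2 * pi * m.+1%:R * x).
  have -> : \int[mu]_(t in I01) (parabola_quotient x t * half_sin x n t) =
      \int[mu]_(t in I01) (x * (1 - x) * dirichlet_kernel n (t - x) -
                           t * (1 - t) * dirichlet_kernel n (t - x)).
    apply: eq_Rintegral => t; rewrite inE/= in_itv/= => t01.
    rewrite /half_sin -dirichlet_kernelE /parabola_quotient -mulrBl.
    have [s0|s0] := eqVneq (sin (pi * (t - x))) 0; last
      by rewrite (mulrC (dirichlet_kernel _ _)) mulrA divfK.
    (* Where the sine vanishes, [|t - x|] is 0 or 1, and the parabola takes the same value at [t]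
       and [x]; so both sides are 0. *)
    rewrite s0 !mulr0.
    have Hs : sin (pi * `|t - x|) = 0.
      have [h|h] := leP 0 (t - x); first by rewrite (ger0_norm h).
      by rewrite (ltr0_norm h) mulrN sinN s0 oppr0.
    have := @sin_pi_ge_parabola R `|t - x|; rewrite Hs normr_ge0 ler_norml/= => H.
    have {}H : `|t - x| * (1 - `|t - x|) <= 0 by apply: H; lra.
    suff -> : x * (1 - x) - t * (1 - t) = 0 by rewrite mul0r.
    by move: H; have [h|/ltW h] := leP 0 (t - x); [rewrite (ger0_norm h)|rewrite (ler0_norm h)]; nra.
  rewrite Rintegral01B ?Rintegral01Zl ?ID ?IPD; [|by solve_bm..].
  by rewrite mulr1; ring.
have := half_sin_coef_cvg0 x bh; rewrite (funext key) => h0.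
rewrite -[X in _ --> X]addr0.
rewrite (_ : (fun n => _) = (fun n => (6^-1 - x * (1 - x)) + (x * (1 - x) - 6^-1 +
    \sum_(0 <= m < n) (pi * m.+1%:R) ^- 2 * cos (2 * pi * m.+1%:R * x)))).
  by apply: cvgD h0; exact: cvg_cst.
by apply/funext => n; rewrite addrA addrC addrA; set S := \sum_(_ <= _ < _) _; ring.
Qed.

End ParabolaSeries.

(** * Smooth positive kernels with small support *)

Section Kernel.
Context {R : realType}.
Implicit Types (t x h : R) (m n p : nat) (a b : nat -> R) (Phi Psi : R -> R).
Local Notation mu := (@lebesgue_measure R).
Local Notation I01 := (`[0%R, 1%R]%classic : set R).

(** Induction works on the sharper bound [2 - n^-1], by telescoping. *)
Lemma sum_inv_sqr_le n : \sum_(0 <= m < n) (m.+1%:R : R) ^- 2 <= 2.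
Proof.
suff H : (0 < n)%N -> \sum_(0 <= m < n) (m.+1%:R : R) ^- 2 <= 2 - n%:R^-1.
  case: n H => [|n] H; first by rewrite big_geq.
  by apply: le_trans (H isT) _; rewrite gerBl invr_ge0.
case: n => // n _; elim: n => [|n IH].
  by rewrite big_nat1 expr1n invr1; lra.
rewrite big_nat_recr//= (le_trans (lerD IH (lexx _)))// -subr_ge0 -[n.+2%:R]natr1.
have n0 : 0 < n.+1%:R :> R by rewrite ltr0n.
have -> : 2 - (n.+1%:R + 1)^-1 - (2 - n.+1%:R^-1 + (n.+1%:R + 1) ^- 2) =
    (n.+1%:R * (n.+1%:R + 1) ^+ 2)^-1 :> R.
  by field; rewrite !gt_eqF// addr_gt0.
by rewrite invr_ge0 mulr_ge0// ?ltW// exprn_gt0// addr_gt0.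
Qed.

Lemma sum_decay_le a (K : R) p n : (2 <= p)%N ->
  (forall m, `|a m| <= K / m.+1%:R ^+ p) ->
  \sum_(0 <= m < n) `|a m| <= K * 2.
Proof.
move=> p2 aK; have K0 : 0 <= K.
  by have := le_trans (normr_ge0 _) (aK 0%N); rewrite expr1n divr1.
apply: (@le_trans _ _ (K * \sum_(0 <= m < n) (m.+1%:R : R) ^- 2)).
  rewrite mulr_sumr; apply: ler_sum => m _; apply: le_trans (aK m) _.
  rewrite ler_wpM2l// lef_pV2 ?posrE ?exprn_gt0//.
  by apply: ler_weXn2l => //; rewrite ler1n.
by rewrite ler_wpM2l// sum_inv_sqr_le.
Qed.

Lemma cvg_sum_single (c : nat -> R) n : (forall m, m != n -> c m = 0) ->
  (fun N => \sum_(0 <= m < N) c m) @ \oo --> c n.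
Proof.
move=> c0; apply: cvg_near_cst; near=> N.
have nN : (n < N)%N by near: N; exact: nbhs_infty_gt.
by rewrite big_mkord (bigD1 (Ordinal nN))//= big1 ?addr0// => i ni; rewrite c0.
Unshelve. all: by end_near. Qed.

(* Weight of frequency n in a cosine series: Phi = \sum_n kappa n * c n * cos(n .)
   when c n is the n-th Fourier coefficient of Phi. *)
Definition kappa n : R := if n == 0%N then 1 else 2.

Lemma kappa_gt0 n : 0 < kappa n. Proof. by rewrite /kappa; case: ifP. Qed.

Lemma kappa_ge1 n : 1 <= kappa n.
Proof. by rewrite /kappa; case: ifP => // _; lra. Qed.

Lemma Rintegral01_coscos m n :
  \int[mu]_(t in I01) (cos (2 * pi * m%:R * t) * cos (2 * pi * n%:R * t)) =
  if m == n then (kappa n)^-1 else 0.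
Proof.
wlog mn : m n / (n <= m)%N => [H|].
  case/orP: (leq_total n m) => [/H//|/H]; rewrite eq_sym.
  under eq_Rintegral do rewrite mulrC.
  by case: eqP => // -> .
have E t : cos (2 * pi * m%:R * t) * cos (2 * pi * n%:R * t) =
    2^-1 * cos (2 * pi * (m - n)%N%:R * t + 0) + 2^-1 * cos (2 * pi * (m + n)%N%:R * t + 0).
  rewrite cosM_sum !addr0 -mulrBl -mulrDl -mulrBr -mulrDr -natrB// -natrD.
  by rewrite mulrC mulrDr.
under eq_Rintegral do rewrite E.
rewrite Rintegral01D; [|by solve_bm..].
rewrite !Rintegral01Zl; [|by solve_bm..].
case: eqVneq => [->|nm].
  rewrite subnn /kappa; under eq_Rintegral do rewrite mulr0 mul0r addr0 cos0.
  rewrite Rintegral01_cst; case: eqVneq => [->|n0].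
    under eq_Rintegral do rewrite mulr0 mul0r addr0 cos0.
    by rewrite Rintegral01_cst; field.
  by rewrite Rintegral01_cos ?mulr0 ?addr0 ?mulr1// addn_gt0 lt0n n0.
have {nm}mn' : (n < m)%N by rewrite ltn_neqAle eq_sym nm.
rewrite !Rintegral01_cos ?mulr0 ?addr0 ?subn_gt0//.
by rewrite addn_gt0 (leq_ltn_trans _ mn').
Qed.

Lemma Rintegral01_cossin m n :
  \int[mu]_(t in I01) (cos (2 * pi * m%:R * t) * sin (2 * pi * n%:R * t)) = 0.
Proof.
have E t : cos (2 * pi * m%:R * t) * sin (2 * pi * n%:R * t) =
    2^-1 * sin (2 * pi * (n + m)%N%:R * t + 0) +
    2^-1 * sin (2 * pi * (n%:R - m%:R) * t + 0).
  rewrite mulrC sincosM_sum !addr0 -mulrDl -mulrBl -mulrDr -mulrBr natrD.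
  by rewrite [LHS]mulrDl; congr (_ + _); rewrite mulrC.
under eq_Rintegral do rewrite E.
rewrite Rintegral01D; [|by solve_bm..].
rewrite !Rintegral01Zl; [|by solve_bm..].
have sin0 k : \int[mu]_(t in I01) sin (2 * pi * k%:R * t + 0) = 0.
  case: k => [|k]; last exact: Rintegral01_sin.
  by under eq_Rintegral do rewrite mulr0 mul0r addr0 sin0; rewrite Rintegral01_cst.
rewrite sin0 mulr0 add0r; have [nm|/ltW nm] := leP m%:R (n%:R : R).
  by move: nm; rewrite ler_nat => nm; rewrite -natrB// sin0 mulr0.
under eq_Rintegral do rewrite -opprB mulrN mulNr addr0 sinN -[2 * _ * _ * _]addr0.
move: nm; rewrite ler_nat => nm; rewrite -natrB//.
under eq_Rintegral do rewrite -mulN1r.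
by rewrite Rintegral01Zl ?sin0 ?mulr0//; solve_bm.
Qed.

Lemma Rintegral01_sinsin m n :
  \int[mu]_(t in I01) (sin (2 * pi * m%:R * t) * sin (2 * pi * n%:R * t)) =
  if (m == n) && (0 < n)%N then 2^-1 else 0.
Proof.
have [m0|m0] := posnP m.
  rewrite m0 (_ : (0%N == n) && (0 < n)%N = false); last by case: n.
  under eq_Rintegral do rewrite mulr0 mul0r sin0 mul0r.
  exact: Rintegral01_cst.
have [n0|n0] := posnP n.
  rewrite n0 andbF; under eq_Rintegral do rewrite [X in _ * sin (X * _)]mulr0 mul0r sin0 mulr0.
  exact: Rintegral01_cst.
have E (t : R) : sin (2 * pi * m%:R * t) * sin (2 * pi * n%:R * t) =
    cos (2 * pi * m%:R * t) * cos (2 * pi * n%:R * t) - cos (2 * pi * (m + n)%N%:R * t + 0).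
  rewrite addr0 natrD (_ : 2 * pi * (m%:R + n%:R) * t =
    2 * pi * m%:R * t + 2 * pi * n%:R * t); last by ring.
  by rewrite cosD; ring.
under eq_Rintegral do rewrite E.
rewrite Rintegral01B; [|by solve_bm..].
rewrite Rintegral01_coscos Rintegral01_cos ?addn_gt0 ?m0// subr0 andbT.
by rewrite /kappa (gtn_eqF n0).
Qed.

(** Smoothness of order [p] is encoded as decay of the cosine coefficients, and [a 0 = 1] says that
    the mean is 1. The support is located by [|sin (pi t)|], half the chord from [turn t] to 1,
    which depends only on [t] modulo 1. *)
Record smooth_kernel p h a Phi : Prop := SmoothKernel {
  kernel_coef0 : a 0%N = 1 ;
  kernel_decay : exists K, forall m, `|a m| <= K / m.+1%:R ^+ p ;
  kernel_series : forall t,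
    (fun n => \sum_(0 <= m < n) a m * cos (2 * pi * m%:R * t)) @ \oo --> Phi t ;
  kernel_ge0 : forall t, 0 <= Phi t ;
  kernel_support : forall t, h <= `|sin (pi * t)| -> Phi t = 0 }.

Section KernelTheory.
Variables (p : nat) (h : R) (a : nat -> R) (Phi : R -> R).
Hypotheses (p2 : (2 <= p)%N) (kP : smooth_kernel p h a Phi).

Lemma kernel_summable : exists S, forall n, \sum_(0 <= m < n) `|a m| <= S.
Proof.
have [K aK] := kernel_decay kP.
by exists (K * 2) => n; exact: sum_decay_le p2 aK.
Qed.

Let cosm m : measurable_fun I01 (fun t : R => cos (2 * pi * m%:R * t)).
Proof. by case: (bounded_measurable_cos_mul I01 (2 * pi * m%:R)). Qed.

Lemma bm_kernel : bounded_measurable I01 Phi.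
Proof.
have [S aS] := kernel_summable.
apply: (bounded_measurable_series aS cosm) => [m t _|t _]; first exact: cos_max.
exact: kernel_series kP t.
Qed.

Lemma cvg_Rintegral_kernel (v : R -> R) : bounded_measurable I01 v ->
  (fun n => \sum_(0 <= m < n) a m * \int[mu]_(t in I01) (cos (2 * pi * m%:R * t) * v t))
  @ \oo --> \int[mu]_(t in I01) (Phi t * v t).
Proof.
move=> bv; have [S aS] := kernel_summable.
apply: (cvg_Rintegral_series measurable01 lebesgue01_fin aS cosm) => // [m t _|t _].
  exact: cos_max.
exact: kernel_series kP t.
Qed.

Let bcos m : bounded_measurable I01 (fun t : R => cos (2 * pi * m%:R * t)).
Proof. exact: bounded_measurable_cos_mul. Qed.

Let bsin m : bounded_measurable I01 (fun t : R => sin (2 * pi * m%:R * t)).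
Proof. exact: bounded_measurable_sin_mul. Qed.

Lemma kernel_cos_coef n :
  \int[mu]_(t in I01) (Phi t * cos (2 * pi * n%:R * t)) = a n / kappa n.
Proof.
have := cvg_Rintegral_kernel (bcos n).
rewrite (funext (fun N => eq_bigr _ (fun m _ => congr1 (fun z => a m * z)
  (Rintegral01_coscos m n)))).
move=> /cvg_lim <-//; apply/cvg_lim => //.
rewrite (_ : a n / kappa n =
  (fun m => a m * (if m == n then (kappa n)^-1 else 0)) n); last first.
  by rewrite /= eqxx.
by apply: cvg_sum_single => m /negbTE ->; rewrite mulr0.
Qed.

Lemma kernel_sin_coef n :
  \int[mu]_(t in I01) (Phi t * sin (2 * pi * n%:R * t)) = 0.
Proof.
have := cvg_Rintegral_kernel (bsin n).
rewrite (funext (fun N => eq_bigr _ (fun m _ => congr1 (fun z => a m * z)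
  (Rintegral01_cossin m n)))).
move=> /cvg_lim <-//; apply/cvg_lim => //.
by apply: cvg_near_cst; apply: nearW => N; rewrite big1// => m _; rewrite mulr0.
Qed.

Lemma kernel_integral : \int[mu]_(t in I01) Phi t = 1.
Proof.
transitivity (a 0%N / kappa 0%N); last by rewrite (kernel_coef0 kP) /kappa eqxx divr1.
rewrite -kernel_cos_coef; apply: eq_Rintegral => t _.
by rewrite mulr0 mul0r cos0 mulr1.
Qed.

(** [Phi] is a probability density, and on its support [1 - cos (2 pi n t) = 2 sin (pi n t) ^ 2] is
    at most [2 (n h) ^ 2]. This is the quantitative form of approximate identity that
    [multiplier_sum_le] takes as input. *)
Lemma kernel_coef_dist1 n : `|1 - a n / kappa n| <= 2 * (n%:R * h) ^+ 2.
Proof.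
have bPhi := bm_kernel.
have -> : 1 - a n / kappa n =
    \int[mu]_(t in I01) (Phi t - Phi t * cos (2 * pi * n%:R * t)).
  by rewrite Rintegral01B ?kernel_integral ?kernel_cos_coef//; solve_bm.
have b1 : bounded_measurable I01 (fun t : R => Phi t - Phi t * cos (2 * pi * n%:R * t)).
  by apply: bounded_measurableB => //; exact: bounded_measurableM.
apply: le_trans (normr_Rintegral01 b1) _.
have -> : 2 * (n%:R * h) ^+ 2 = \int[mu]_(t in I01) (2 * (n%:R * h) ^+ 2 * Phi t).
  by rewrite Rintegral01Zl// kernel_integral mulr1.
apply: le_Rintegral01.
- exact: bounded_measurable_norm.
- by solve_bm.
move=> t _; rewrite -{1}[Phi t]mulr1 -mulrBr normrM (ger0_norm (kernel_ge0 kP t)).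
have [/(kernel_support kP) ->|th] := leP h `|sin (pi * t)|; first
  by rewrite mul0r mulr0.
rewrite mulrC ler_wpM2r ?(kernel_ge0 kP)//.
have -> : 2 * pi * n%:R * t = 2 * (n%:R * (pi * t)) by ring.
rewrite cos_double normrM ger0_norm// ler_wpM2l// normrX.
rewrite lerXn2r ?nnegrE ?mulr_ge0//; first by rewrite (le_trans _ (ltW th)).
by rewrite (le_trans (sin_natM_le _ _))// ler_wpM2l// ltW.
Qed.

Lemma kernel_coef_le1 n : `|a n / kappa n| <= 1.
Proof.
have bPhi := bm_kernel.
rewrite -kernel_cos_coef -[leRHS]kernel_integral.
apply: le_trans (normr_Rintegral01 _) _; first by solve_bm.
apply: le_Rintegral01 => //.
  by apply: bounded_measurable_norm; solve_bm.
move=> t _; rewrite normrM (ger0_norm (kernel_ge0 kP t)) ler_piMr ?cos_max//.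
exact: kernel_ge0 kP t.
Qed.

End KernelTheory.

(** The Fourier coefficients [a m / kappa m] and [b m / kappa m] multiply under convolution, which
    leaves one division by [kappa m] in the cosine coefficient. Widths add because [|sin|] is
    subadditive. *)
Lemma smooth_kernel_conv p q h k a b Phi Psi : (2 <= p)%N -> (2 <= q)%N ->
  smooth_kernel p h a Phi -> smooth_kernel q k b Psi ->
  smooth_kernel (p + q) (h + k) (fun m => a m * (b m / kappa m))
    (fun x => \int[mu]_(s in I01) (Phi (x - s) * Psi s)).
Proof.
move=> p2 q2 kP kQ; split.
- by rewrite (kernel_coef0 kP) (kernel_coef0 kQ) /kappa eqxx divr1 mulr1.
- have [K aK] := kernel_decay kP; have [L bL] := kernel_decay kQ.
  exists (K * L) => m; rewrite exprD invfM mulrACA normrM ler_pM//.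
  apply: le_trans (bL m); rewrite normrM ler_piMr// normfV (ger0_norm (ltW (kappa_gt0 m))).
  by rewrite invf_le1 ?kappa_gt0// kappa_ge1.
- move=> x; have [S aS] := kernel_summable p2 kP.
  pose u m s : R := cos (2 * pi * m%:R * (x - s)).
  have uE m s : u m s = cos (- (2 * pi * m%:R) * s + 2 * pi * m%:R * x).
    by rewrite /u; congr cos; ring.
  have uD m : u m = (fun s => cos (2 * pi * m%:R * x) * cos (2 * pi * m%:R * s) +
      sin (2 * pi * m%:R * x) * sin (2 * pi * m%:R * s)).
    by apply/funext => s; rewrite /u mulrBr cosB.
  have bQ := bm_kernel q2 kQ.
  have mu_ m : measurable_fun I01 (u m).
    rewrite (funext (uE m)).
    by case: (bounded_measurable_cos_affine I01 (- (2 * pi * m%:R))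
      (2 * pi * m%:R * x)).
  have := @cvg_Rintegral_series _ _ _ mu I01 measurable01 lebesgue01_fin a u
    (fun s => Phi (x - s)) S aS mu_ _ _ Psi bQ.
  move=> H; have {}H := H (fun m s _ => cos_max _)
    (fun s _ => @kernel_series _ _ _ _ kP (x - s)).
  apply: cvg_trans H; apply: near_eq_cvg; apply: nearW => n; apply: eq_bigr => m _.
  rewrite -mulrA; congr (_ * _).
  have bc : bounded_measurable I01 (fun t : R => Psi t * cos (2 * pi * m%:R * t)).
    by solve_bm.
  have bs : bounded_measurable I01 (fun t : R => Psi t * sin (2 * pi * m%:R * t)).
    by solve_bm.
  transitivity (\int[mu]_(s in I01)
    (cos (2 * pi * m%:R * x) * (Psi s * cos (2 * pi * m%:R * s)) +
      sin (2 * pi * m%:R * x) * (Psi s * sin (2 * pi * m%:R * s)))).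
    by apply: eq_Rintegral => s _; rewrite uD; ring.
  rewrite Rintegral01D; [|by solve_bm..].
  rewrite !Rintegral01Zl// (kernel_cos_coef q2 kQ) (kernel_sin_coef q2 kQ).
  by rewrite mulr0 addr0 mulrC.
- by move=> x; apply: Rintegral_ge0 => s _;
  rewrite mulr_ge0 ?(kernel_ge0 kP) ?(kernel_ge0 kQ).
- move=> x hkx; rewrite -[RHS](Rintegral01_cst 0); apply: eq_Rintegral => s _.
  have [/(kernel_support kQ) ->|sk] := leP k `|sin (pi * s)|; first by rewrite mulr0.
  rewrite (kernel_support kP) ?mul0r// -(lerD2r k) (le_trans hkx)//.
  have -> : pi * x = pi * (x - s) + pi * s by ring.
  by rewrite (le_trans (norm_sinD_le _ _))// lerD2l ltW.
Qed.

(** An even 1-periodic function is determined by its values on [0, 1/2]; this allows the triangle to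
    be given by a formula there. *)
Lemma dist_to_nat t : exists d, [/\ 0 <= d <= 1 / 2,
  forall m, cos (2 * pi * m%:R * t) = cos (2 * pi * m%:R * d) &
  `|sin (pi * t)| = `|sin (pi * d)|].
Proof.
wlog t0 : t / 0 <= t => [H|].
  have [/H//|/ltW t0] := leP 0 t.
  have [|d [d0 dc ds]] := H (- t); first by rewrite oppr_ge0.
  exists d; split => // [m|]; first by rewrite -dc mulrN cosN.
  by rewrite -ds mulrN sinN normrN.
have /andP[jt tj] := truncn_itv t0; set j := Num.truncn t in jt tj.
set r := t - j%:R; have tE : t = r + j%:R by rewrite subrK.
have r0 : 0 <= r by rewrite subr_ge0.
have r1 : r < 1 by rewrite ltrBlDl natr1.
have c m : cos (2 * pi * m%:R * t) = cos (2 * pi * m%:R * r).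
  by rewrite tE mulrDr -(mulrA (2 * pi) m%:R j%:R) -natrM cosD2pin.
have s : `|sin (pi * t)| = `|sin (pi * r)|.
  by rewrite tE mulrDr norm_sinDpin.
have [r2|/ltW r2] := leP r (1 / 2); first by exists r; split => //; rewrite r0.
exists (1 - r); split; first by lra.
  by move=> m; rewrite c -[LHS]cosN -[LHS](cosD2pin _ m); congr cos; ring.
by rewrite s (mulrBr pi 1 r) mulr1 addrC sinDpi sinN opprK.
Qed.

(* The second difference of the 1-periodic parabola t (1 - t) with step g is,
   up to a constant, a triangle of half-width g. *)
Lemma smooth_kernel_triangle h : 0 < h -> exists a Phi, smooth_kernel 2 h a Phi.
Proof.
(* The bound [g <= 1/4] keeps [d + g] and [|d - g|] in [0, 1], where the parabola expansion holds.
   The bound [4 g <= h] and [pi < 4] put the support inside the required width. *)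
move=> h0; pose g := Num.min h 1 / 4.
have g0 : 0 < g by rewrite divr_gt0// lt_min h0 ltr01.
have g4 : g <= 1 / 4 by rewrite ler_wpM2r// ge_min lexx orbT.
have gh : 4 * g <= h by rewrite /g mulrC divfK// ge_min lexx.
pose a m : R := if m == 0%N then 1 else
  (pi * m%:R) ^- 2 * (1 - cos (2 * pi * m%:R * g)) / g ^+ 2.
(* Height [1 / g] and half-width [g], hence mean 1 over a period. *)
pose T d : R := if d <= g then (g - d) / g ^+ 2 else 0.
have conv d : 0 <= d <= 1 / 2 ->
    (fun n => \sum_(0 <= m < n) a m * cos (2 * pi * m%:R * d)) @ \oo --> T d.
  move=> /andP[d0 d2]; rewrite -(cvg_shiftS _ _).
  pose p x n : R := \sum_(0 <= m < n) (pi * m.+1%:R) ^- 2 * cos (2 * pi * m.+1%:R * x).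
  have -> : [sequence \sum_(0 <= m < n.+1) a m * cos (2 * pi * m%:R * d)]_n =
      (fun n => 1 + g ^- 2 * (p d n - (2^-1 * p (d + g) n + 2^-1 * p `|d - g| n))).
    apply/funext => n; rewrite /= big_nat_recl//= mulr0 mul0r cos0 mulr1; congr (_ + _).
    rewrite /p !mulr_sumr -big_split/= -sumrB mulr_sumr; apply: eq_bigr => m _.
    rewrite /a/=.
    have -> : cos (2 * pi * m.+1%:R * `|d - g|) = cos (2 * pi * m.+1%:R * (d - g)).
      have [k|k] := leP 0 (d - g); first by rewrite (ger0_norm k).
      by rewrite (ltr0_norm k) mulrN cosN.
    rewrite (mulrDr _ d g) (mulrBr _ d g) cosB cosD.
    by move: ((pi * m.+1%:R) ^- 2) => P; field; rewrite gt_eqF.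
  pose P x : R := 6^-1 - x * (1 - x).
  have -> : T d = 1 + g ^- 2 * (P d - (2^-1 * P (d + g) + 2^-1 * P `|d - g|)).
    rewrite /T; have [k|/ltW k] := leP d g.
      rewrite ler0_norm ?subr_le0// /P.
      by field; rewrite gt_eqF.
    rewrite ger0_norm ?subr_ge0// /P.
    by field; rewrite gt_eqF.
  have cp x : 0 <= x <= 1 -> p x @ \oo --> P x by exact: cvg_parabola_series.
  apply: cvgD; first exact: cvg_cst.
  apply: cvgM; first exact: cvg_cst.
  apply: cvgB; first by apply: cp; lra.
  apply: cvgD; (apply: cvgM; first exact: cvg_cst); apply: cp; first by lra.
  by rewrite normr_ge0 ler_norml; lra.
pose D t := projT1 (cid (dist_to_nat t)).
have DP t : [/\ 0 <= D t <= 1 / 2,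
  forall m, cos (2 * pi * m%:R * t) = cos (2 * pi * m%:R * D t) &
  `|sin (pi * t)| = `|sin (pi * D t)|] by exact: projT2 (cid (dist_to_nat t)).
exists a, (fun t => T (D t)); split.
- by [].
(* The 8 is 2 for [1 - cos] times 4 for replacing [(pi m) ^- 2] by [(m + 1) ^- 2]; the 1 covers
   [m = 0]. *)
- exists (1 + 8 / g ^+ 2) => m; rewrite /a; case: m => [|m].
    by rewrite eqxx normr1 expr1n divr1 lerDl divr_ge0// sqr_ge0.
  rewrite /= !normrM !normfV !normrX (ger0_norm (ltW g0)).
  rewrite (@ger0_norm _ (pi * _)) ?mulr_ge0 ?pi_ge0//.
  have c2 : `|1 - cos (2 * pi * m.+1%:R * g)| <= 2.
    rewrite (le_trans (ler_normB _ _))// normr1.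
    by have := cos_max (2 * pi * m.+1%:R * g); lra.
  have q : (pi * m.+1%:R) ^- 2 <= 4 * (m.+2%:R ^- 2 : R).
    rewrite -[4]invrK -invfM lef_pV2 ?posrE ?exprn_gt0 ?mulr_gt0 ?pi_gt0 ?invr_gt0//.
    have e2 : m.+2%:R <= 2 * m.+1%:R :> R by rewrite -natrM ler_nat; lia.
    have e3 : m.+1%:R <= pi * m.+1%:R :> R.
      by rewrite ler_peMl// (le_trans _ (pi_ge2 R))//; lra.
    have e4 : 0 <= m.+2%:R :> R by [].
    have e5 : (2 * m.+1%:R) ^+ 2 = 4 * m.+1%:R ^+ 2 :> R by ring.
    have e6 : m.+2%:R ^+ 2 <= (2 * m.+1%:R) ^+ 2 :> R
      by rewrite lerXn2r ?nnegrE ?mulr_ge0.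
    have e7 : m.+1%:R ^+ 2 <= (pi * m.+1%:R) ^+ 2 :> R
      by rewrite lerXn2r ?nnegrE ?mulr_ge0 ?pi_ge0.
    lra.
  apply: (@le_trans _ _ (4 * m.+2%:R ^- 2 * 2 / g ^+ 2)).
    rewrite ler_wpM2r ?invr_ge0 ?sqr_ge0// ler_pM// ?invr_ge0 ?sqr_ge0//.
  rewrite -subr_ge0; set X := m.+2%:R ^- 2; set G := g ^- 2.
  have -> : (1 + 8 * G) * X - 4 * X * 2 * G = X by ring.
  by rewrite invr_ge0 sqr_ge0.
- move=> t; have [d0 dc _] := DP t; have := conv _ d0.
  by under eq_fun do under eq_bigr do rewrite -dc.
- move=> t; rewrite /T; case: ifP => // k.
  by rewrite divr_ge0 ?sqr_ge0// subr_ge0.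
- move=> t; have [/andP[d0 d2] _ ->] := DP t => hs; rewrite /T; case: ifP => // dg.
  have p4 : pi < 4 :> R by have := pihalf_lt2 R; lra.
  have := le_trans hs (norm_sin_le _); rewrite ger0_norm ?mulr_ge0 ?pi_ge0// => hd.
  have -> : D t = g by have := pi_ge2 R; nra.
  by rewrite subrr mul0r.
Qed.

(** Each convolution with a triangle gains two orders; giving each factor half of the available
    width keeps the total equal to [h]. *)
Lemma smooth_kernel_exists p h : 0 < h ->
  exists q a Phi, [/\ (2 <= q)%N, (p <= q)%N & smooth_kernel q h a Phi].
Proof.
move=> h0; have {}h0 : 0 < h by [].
elim: p h h0 => [|p IH] h h0.
  have [a [Phi k]] := smooth_kernel_triangle h0.
  by exists 2%N, a, Phi.
have h2 : 0 < h / 2 by rewrite divr_gt0.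
have [q [a [Phi [q2 pq k]]]] := IH _ h2.
have [b [Psi k']] := smooth_kernel_triangle h2.
exists (q + 2)%N; do 2 eexists; split; last first.
- by rewrite [h](splitr); exact: smooth_kernel_conv k k'.
- lia.
- lia.
Qed.

End Kernel.

(** * Weights *)

Section Weights.
Context {R : realType}.
Variable w : nat -> {posnum R}.

(* The only consequence of the hypotheses on w that the construction uses. The
   sum of truncated subtractions is the distance |n - k N|. *)
Definition sparse_small (A : nat) := forall (e : R) (N0 : nat), 0 < e ->
  exists2 N, (N0 < N)%N & forall k n, (0 < k)%N ->
    (w n)%:num <= e ^+ 2 *
      ((1 + ((n - k * N) + (k * N - n)))%N%:R * (1 + k)%N%:R) ^+ (2 * A).

Hypothesis w_liminf : limn_einf (fun n => ((w n)%:num)%:E) = 0%E.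

Lemma liminf_small (e : R) (N0 : nat) : 0 < e ->
  exists2 N, (N0 < N)%N & (w N)%:num < e.
Proof.
move=> e0; apply: contrapT => H.
have : (e%:E <= limn_einf (fun n => ((w n)%:num)%:E))%E; last first.
  by rewrite w_liminf lee_fin leNgt e0.
rewrite limn_einf_lim; apply: lime_ge; first exact: is_cvg_einfs.
exists N0.+1 => // n /= N0n; apply: le_ereal_inf_tmp => _ [m /= nm <-].
rewrite lee_fin leNgt; apply/negP => wm; apply: H; exists m => //.
exact: leq_trans N0n nm.
Qed.

(** Beyond an index [M] with [w M < e ^ 2], monotonicity suffices. The indices below [M] are far
    from every positive multiple of a large [N], and the factor [1 + |n - k N|] compensates for
    [w 0]. *)
Lemma sparse_small_nonincreasing :
  nonincreasing_seq (fun n => (w n)%:num) -> sparse_small 1.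
Proof.
move=> dw e N0 e0; have e20 : 0 < e ^+ 2 by rewrite exprn_gt0.
have [M _ wM] := liminf_small 0 e20.
pose B := Num.truncn ((w 0%N)%:num * 2 / e ^+ 2).
(* [N > 2 M] gives [|n - k N| >= N / 2] for [n < M], and [N > B] gives [N / 2 >= w 0 / e ^ 2]. *)
exists (N0 + 2 * M + B).+1; first by lia.
move=> k n k0; set N := (N0 + 2 * M + B).+1; set d := ((n - k * N) + (k * N - n))%N.
have X1 : 1 <= (1 + d)%N%:R * (1 + k)%N%:R :> R by rewrite -natrM ler1n; lia.
have [Mn|nM] := leqP M n.
  apply: le_trans (dw _ _ Mn) _; apply: le_trans (ltW wM) _.
  by rewrite ler_peMr ?(ltW e20)// exprn_ege1.
have dN : (N <= 2 * d)%N.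
  have : (N <= k * N)%N by rewrite leq_pmull.
  by rewrite /d; move: (k * N)%N => kN; rewrite /N; lia.
apply: (@le_trans _ _ (w 0%N)%:num); first exact: dw.
have wB : (w 0%N)%:num * 2 / e ^+ 2 <= (2 * d)%N%:R.
  apply: le_trans (_ : N%:R <= _); last by rewrite ler_nat.
  have t0 : 0 <= (w 0%N)%:num * 2 / e ^+ 2 by rewrite divr_ge0 ?mulr_ge0// ltW.
  have /andP[_ /ltW] := truncn_itv t0; move=> /le_trans; apply.
  by rewrite ler_nat /N /B; lia.
have wd : (w 0%N)%:num <= e ^+ 2 * d%:R.
  by move: wB; rewrite ler_pdivrMr// natrM; lra.
apply: le_trans wd _; rewrite ler_wpM2l ?sqr_ge0//.
apply: (@le_trans _ _ ((1 + d)%N%:R * (1 + k)%N%:R)).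
  by rewrite -natrM ler_nat; nia.
by rewrite muln1 expr2 ler_peMr// (le_trans ler01).
Qed.

(** * Weights with the doubling property *)

Section Doubling.
Variable C : R.
Hypothesis C1 : 1 < C.
Hypothesis wC : forall n : nat, (1 <= n)%N -> forall k : nat, (n <= k <= 2 * n)%N ->
  C^-1 * (w n)%:num <= (w k)%:num <= C * (w n)%:num.

Lemma doubling_iter l m n : (0 < m)%N -> (m <= n)%N -> (n <= 2 ^ l * m)%N ->
  (w n)%:num <= C ^+ l * (w m)%:num /\ (w m)%:num <= C ^+ l * (w n)%:num.
Proof.
have C0 : 0 < C := lt_trans ltr01 C1.
elim: l m => [|l IH] m m0 mn nl.
  have -> : n = m by apply/eqP; rewrite eqn_leq mn andbT; move: nl; rewrite expn0 mul1n.
  by rewrite expr0 mul1r.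
have [n2|n2] := leqP n (2 * m).
  have /andP[h1 h2] : C^-1 * (w m)%:num <= (w n)%:num <= C * (w m)%:num.
    by apply: wC => //; rewrite mn n2.
  have h3 : (w m)%:num <= C * (w n)%:num by move: h1; rewrite ler_pdivrMl.
  have Cl : 1 <= C ^+ l by rewrite exprn_ege1// ltW.
  rewrite exprS -!mulrA; split.
    by apply: le_trans h2 _; rewrite ler_wpM2l ?(ltW C0)// ler_peMl.
  by apply: le_trans h3 _; rewrite ler_wpM2l ?(ltW C0)// ler_peMl.
have [|||h1 h2] := IH (2 * m)%N; [by lia|by lia|by move: nl; rewrite expnS; lia|].
have /andP[h3 h4] : C^-1 * (w m)%:num <= (w (2 * m)%N)%:num <= C * (w m)%:num.
  by apply: wC => //; lia.
have h5 : (w m)%:num <= C * (w (2 * m)%N)%:num by move: h3; rewrite ler_pdivrMl.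
have Cl : 0 <= C ^+ l by rewrite exprn_ge0// ltW.
split.
  by apply: le_trans h1 _; rewrite exprSr -mulrA ler_wpM2l.
by apply: le_trans h5 _; rewrite exprS -mulrA ler_wpM2l// ltW.
Qed.

(** With [X = (1 + |n - k N|) (1 + k)] one has [n <= N X] and, for [n > 0], [N <= n X]. So about
    log2 X doublings join [N] and [n]; their cost [C ^ l] is polynomial in [X] because
    [C <= 2 ^ (A + 1)]. *)
Lemma sparse_small_doubling : exists A, sparse_small A.
Proof.
have C0 : 0 < C := lt_trans ltr01 C1.
pose A := Num.truncn C.
have CA : C <= 2 ^+ A.+1.
  have /andP[_ /ltW CA] := truncn_itv (ltW C0).
  by apply: le_trans CA _; rewrite -natrX ler_nat ltnW// ltn_expl.
exists A.+1 => e N0 e0.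
(* The doubling hypothesis starts at index 1, so [w 0] is compared with [w 1] by hand. *)
pose c := 1 + (w 0%N)%:num / (w 1%N)%:num.
have c1 : 1 <= c by rewrite lerDl divr_ge0.
have c0 : 0 < c by rewrite (lt_le_trans ltr01).
(* Pays for [c] and for the factor lost in [2 ^ l <= 2 * X]. *)
pose e' := e ^+ 2 / (c * 2 ^+ A.+1).
have e'0 : 0 < e' by rewrite divr_gt0 ?exprn_gt0 ?mulr_gt0// exprn_gt0.
have [N N0N wN] := liminf_small N0 e'0.
exists N => // k n k0; set d := ((n - k * N) + (k * N - n))%N.
have NkN : (N <= k * N)%N by rewrite leq_pmull.
pose X := ((1 + d) * (1 + k))%N.
have X0 : (0 < X)%N by rewrite /X muln_gt0.
pose l := (trunc_log 2 X).+1.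
have Xl : (X <= 2 ^ l)%N by rewrite ltnW// trunc_log_ltn.
have lX : (2 ^ l <= 2 * X)%N by rewrite expnS leq_mul2l/= trunc_logP.
have n0 : (0 < N)%N by lia.
have nX : (n <= N * X)%N.
  have : (n <= d + k * N)%N by rewrite /d; lia.
  by rewrite /X; nia.
suff H : (w n)%:num <= c * (C ^+ l * (w N)%:num).
  apply: le_trans H _.
  have Cl : C ^+ l <= 2 ^+ A.+1 * X%:R ^+ A.+1.
    rewrite -exprMn -natrM; apply: (@le_trans _ _ ((2 ^+ A.+1) ^+ l)).
      by rewrite lerXn2r// nnegrE ?ltW// exprn_gt0.
    rewrite -exprM mulnC exprM; rewrite lerXn2r ?nnegrE//.
    by rewrite -natrX ler_nat.
  have -> : e ^+ 2 = e' * (c * 2 ^+ A.+1).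
    by rewrite /e' divfK// mulf_neq0 ?gt_eqF// exprn_gt0.
  rewrite -natrM -/X mulnC exprM [X in _ <= _ * X]expr2.
  have XA : 1 <= X%:R ^+ A.+1 :> R by rewrite exprn_ege1// ler1n.
  apply: (@le_trans _ _ (c * ((2 ^+ A.+1 * X%:R ^+ A.+1) * e'))).
    rewrite ler_wpM2l ?(ltW c0)// ler_pM// ?(ltW wN)//.
    by rewrite exprn_ge0// ltW.
  move: XA e'0 c0; set Y := X%:R ^+ A.+1; set Z := 2 ^+ A.+1 => XA e'0 c0.
  have Z0 : 0 <= Z by rewrite exprn_ge0.
  have -> : e' * (c * Z) * (Y * Y) = c * (Z * Y * e') * Y by ring.
  have Y0 : 0 <= Y := le_trans ler01 XA.
  by rewrite ler_peMr// mulr_ge0 ?(ltW c0)// mulr_ge0 ?(ltW e'0)// mulr_ge0.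
have {}c1' : forall u : R, 0 <= u -> u <= c * u by move=> u u0; rewrite ler_peMl.
have [n1|] := posnP n.
  have NX : (N <= 2 ^ l * 1)%N.
    by apply: leq_trans (_ : X <= _)%N; [rewrite /X /d n1; nia|rewrite muln1].
  have [_ h] := doubling_iter (ltn0Sn 0) n0 NX.
  rewrite n1; apply: le_trans (_ : c * (w 1%N)%:num <= _); last
    by rewrite ler_wpM2l ?(ltW c0).
  by rewrite /c mulrDl mul1r divfK ?lerDr// gt_eqF.
move=> n1; apply: le_trans (c1' _ _); last by rewrite mulr_ge0// exprn_ge0// ltW.
have [nN|/ltnW Nn] := leqP n N.
  apply: (doubling_iter n1 nN _).2; apply: leq_trans (_ : X * n <= _)%N; last
    by rewrite leq_mul2r Xl orbT.
  have : (N <= n + d)%N by rewrite /d; lia.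
  by rewrite /X; nia.
apply: (doubling_iter n0 Nn _).1; apply: leq_trans nX _.
by rewrite mulnC leq_mul2r Xl orbT.
Qed.

End Doubling.
End Weights.

(** * The circle *)

Section Circle.
Context {R : realType}.
Implicit Types (z y : circle R) (t s : R) (n m : nat).
Local Notation I01 := (`[0%R, 1%R]%classic : set R).

Definition turn t : circle R := expi (2 * pi * t).

Definition circle_cos n z : R := complex.Re (val z ^+ n).
Definition circle_sin n z : R := complex.Im (val z ^+ n).

Lemma val_turnX n t :
  val (turn t) ^+ n = (cos (2 * pi * n%:R * t) +i* sin (2 * pi * n%:R * t))%C.
Proof.
elim: n => [|n IH]; first by rewrite expr0 mulr0 mul0r cos0 sin0.
rewrite exprS IH /turn /expi/= -[n.+1%:R]natr1.
rewrite (_ : 2 * pi * (n%:R + 1) * t = 2 * pi * t + 2 * pi * n%:R * t); last by ring.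
rewrite cosD sinD.
by congr Complex; ring.
Qed.

Lemma circle_cos_turn n t : circle_cos n (turn t) = cos (2 * pi * n%:R * t).
Proof. by rewrite /circle_cos val_turnX. Qed.

Lemma circle_sin_turn n t : circle_sin n (turn t) = sin (2 * pi * n%:R * t).
Proof. by rewrite /circle_sin val_turnX. Qed.

Lemma circle_ReIm z : complex.Re (val z) ^+ 2 + complex.Im (val z) ^+ 2 = 1.
Proof.
case: z => z /= /eqP; rewrite normc_def => /(congr1 (@complex.Re R)) /= h.
by rewrite -[LHS]sqr_sqrtr ?addr_ge0 ?sqr_ge0// h expr1n.
Qed.

Lemma turn_surj z : exists2 t, I01 t & z = turn t.
Proof.
have := circle_ReIm z; case: z => -[x y] z1 /= xy.
have x1 : -1 <= x <= 1 by apply/andP; split; have := sqr_ge0 y; nra.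
have pi0 : 0 < pi :> R := pi_gt0 R.
have a0 := acos_ge0 x1; have a1 := acos_lepi x1.
have ca : cos (acos x) = x by rewrite acosK// in_itv.
have sa : sin (acos x) = `|y|.
  by rewrite sin_acos// -sqrtr_sqr; congr Num.sqrt; rewrite -xy; ring.
have tE : 2 * pi * (acos x / (2 * pi)) = acos x
  by rewrite mulrC divfK// gt_eqF// mulr_gt0.
have t0 : 0 <= acos x / (2 * pi) by rewrite divr_ge0// mulr_ge0// ltW.
have t1 : acos x / (2 * pi) <= 1 by rewrite ler_pdivrMr ?mulr_gt0// mul1r; nra.
have [y0|y0] := leP 0 y.
  exists (acos x / (2 * pi)); first by rewrite /= in_itv/= t0 t1.
  by apply: val_inj; rewrite /= tE ca sa ger0_norm.
exists (1 - acos x / (2 * pi)); first by rewrite /= in_itv/=; lra.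
apply: val_inj; rewrite /= mulrBr tE.
have := cosD2pin (- acos x) 1; have := sinD2pin (- acos x) 1.
rewrite addrC => -> ->.
by rewrite cosN sinN ca sa ltr0_norm// opprK.
Qed.

Lemma mdist_turn t s : mdist (turn t) (turn s) = 2 * `|sin (pi * (t - s))|.
Proof.
rewrite mdist_circle /turn /expi /Normc.normc/=.
rewrite -[RHS]ger0_norm ?mulr_ge0// -[RHS]sqrtr_sqr; congr Num.sqrt.
rewrite exprMn real_normK ?num_real//.
have -> : 2 ^+ 2 * sin (pi * (t - s)) ^+ 2 = 2 * (2 * sin (pi * (t - s)) ^+ 2) by ring.
rewrite -cos_double (_ : 2 * (pi * (t - s)) = 2 * pi * t - 2 * pi * s); last by ring.
rewrite cosB.
have := cos2Dsin2 (2 * pi * t); have := cos2Dsin2 (2 * pi * s).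
by move: (cos _) (sin _) (cos _) (sin _) => a b c d; lra.
Qed.

Lemma mdist_turn_le t s : mdist (turn t) (turn s) <= 2 * pi * `|t - s|.
Proof.
rewrite mdist_turn -mulrA ler_wpM2l//.
by apply: le_trans (norm_sin_le _) _; rewrite normrM ger0_norm ?pi_ge0.
Qed.

Lemma lipschitz_continuous_circle (f : circle R -> R) (k : R) :
  (forall z y, `|f z - f y| <= k * mdist z y) -> continuous f.
Proof.
move=> fk z; apply/(@cvgrPdist_lt R R (circle R) (nbhs z) (nbhs_filter z)) => e e0.
have k1 : 0 < `|k| + 1 by rewrite ltr_pwDr.
apply/nbhs_ballP; exists (e / (`|k| + 1)); first by rewrite /= divr_gt0.
move=> y; rewrite ballEmdist/= => zy; apply: le_lt_trans (fk z y) _.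
have m0 := mdist_ge0 z y.
apply: (@le_lt_trans _ _ ((`|k| + 1) * mdist z y)).
  by rewrite ler_wpM2r// (le_trans (ler_norm _))// lerDl.
by move: zy; rewrite ltr_pdivlMr// mulrC.
Qed.

Lemma continuous_turn : continuous turn.
Proof.
move=> t; apply/cvg_ballP => e e0.
have p0 : 0 < 2 * pi :> R by rewrite mulr_gt0 ?pi_gt0.
apply/nbhs_ballP; exists (e / (2 * pi)); first by rewrite /= divr_gt0.
move=> s /=; rewrite /ball/= ltr_pdivlMr// mulrC => ts.
exact: le_lt_trans (mdist_turn_le _ _) ts.
Qed.

Lemma circle_cos_dist n z y : `|circle_cos n z - circle_cos n y| <= n%:R * mdist z y.
Proof.
have [t _ ->] := turn_surj z; have [s _ ->] := turn_surj y.
rewrite !circle_cos_turn mdist_turn.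
have -> : cos (2 * pi * n%:R * t) - cos (2 * pi * n%:R * s) =
    - 2 * (sin (n%:R * (pi * (t + s))) * sin (n%:R * (pi * (t - s)))).
  rewrite sinM_sum (_ : n%:R * (pi * (t + s)) - n%:R * (pi * (t - s)) =
    2 * pi * n%:R * s); last by ring.
  rewrite (_ : n%:R * (pi * (t + s)) + n%:R * (pi * (t - s)) = 2 * pi * n%:R * t);
    last by ring.
  by field.
rewrite normrM normrN normr_nat [leRHS]mulrCA ler_wpM2l// normrM.
apply: le_trans (ler_piMl _ (sin_max _)) _ => //.
exact: sin_natM_le.
Qed.

Lemma circle_sin_dist n z y : `|circle_sin n z - circle_sin n y| <= n%:R * mdist z y.
Proof.
have [t _ ->] := turn_surj z; have [s _ ->] := turn_surj y.
rewrite !circle_sin_turn mdist_turn.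
have -> : sin (2 * pi * n%:R * t) - sin (2 * pi * n%:R * s) =
    2 * (sin (n%:R * (pi * (t - s))) * cos (n%:R * (pi * (t + s)))).
  rewrite sincosM_sum (_ : n%:R * (pi * (t - s)) - n%:R * (pi * (t + s)) =
    - (2 * pi * n%:R * s)); last by ring.
  rewrite (_ : n%:R * (pi * (t - s)) + n%:R * (pi * (t + s)) = 2 * pi * n%:R * t);
    last by ring.
  by rewrite sinN; field.
rewrite normrM normr_nat [leRHS]mulrCA ler_wpM2l// normrM.
apply: le_trans (ler_piMr _ (cos_max _)) _ => //.
exact: sin_natM_le.
Qed.

Lemma continuous_circle_cos n : continuous (circle_cos n).
Proof. exact: lipschitz_continuous_circle (circle_cos_dist n). Qed.

Lemma continuous_circle_sin n : continuous (circle_sin n).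
Proof. exact: lipschitz_continuous_circle (circle_sin_dist n). Qed.

Lemma measurable_open_circle (U : set (circle R)) : open U -> measurable U.
Proof. by move=> oU; exact: sub_sigma_algebra. Qed.

Lemma measurable_closed_circle (U : set (circle R)) : closed U -> measurable U.
Proof.
move=> cU; rewrite -(setCK U); apply: measurableC; apply: measurable_open_circle.
exact: closed_openC.
Qed.

Lemma continuous_measurable_circle (f : circle R -> R) :
  continuous f -> measurable_fun setT f.
Proof.
move=> cf; apply: (measurability _ (RGenOpens.measurableE R)).
move=> _ [_ [a [b ->]] <-]; rewrite setTI; apply: measurable_open_circle.
by move/continuousP : cf; apply; exact: itv_open.
Qed.

Lemma measurable_turn : measurable_fun setT turn.
Proof.
apply: (@measurability _ _ _ _ _ _ (@open (circle R))) => //.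
move=> _ [U oU <-]; rewrite setTI; apply: open_measurable.
by move/continuousP : continuous_turn; apply.
Qed.

Lemma norm_circle_cos n z : `|circle_cos n z| <= 1.
Proof. by have [t _ ->] := turn_surj z; rewrite circle_cos_turn cos_max. Qed.

Lemma norm_circle_sin n z : `|circle_sin n z| <= 1.
Proof. by have [t _ ->] := turn_surj z; rewrite circle_sin_turn sin_max. Qed.

Lemma bm_circle_cos n : bounded_measurable setT (circle_cos n).
Proof.
split; last by exists 1 => z _; exact: norm_circle_cos.
by apply: continuous_measurable_circle; exact: continuous_circle_cos.
Qed.

Lemma bm_circle_sin n : bounded_measurable setT (circle_sin n).
Proof.
split; last by exists 1 => z _; exact: norm_circle_sin.
by apply: continuous_measurable_circle; exact: continuous_circle_sin.
Qed.

Lemma compact_circle : compact [set: circle R].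
Proof.
have -> : [set: circle R] = turn @` I01.
  by apply/seteqP; split => z // _; have [t It ->] := turn_surj z; exists t.
apply: continuous_compact; last exact: segment_compact.
by apply: continuous_subspaceT; exact: continuous_turn.
Qed.

Lemma closed_compact_circle (A : set (circle R)) : closed A -> compact A.
Proof. by move=> cA; exact: subclosed_compact cA compact_circle _. Qed.

Lemma closed_dist_to (E : set (circle R)) (r : R) : E !=set0 ->
  closed [set z | dist_to z E <= r].
Proof.
move=> E0; have cf : continuous (dist_to ^~ E : circle R -> R).
  apply: (@lipschitz_continuous_circle _ 1) => z y; rewrite mul1r ler_norml.
  have := dist_to_triangle z y E0; have := dist_to_triangle y z E0.
  by rewrite (metric_sym y z); lra.
by apply: (@preimage_closed _ _ (dist_to ^~ E) [set u | u <=
  r]) => [z _|]; [exact: cf|exact: closed_le].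
Qed.

Lemma closed_circle_cos_ge n (r : R) : closed [set z | r <= circle_cos n z].
Proof.
apply: (@preimage_closed _ _ (circle_cos n) [set u | r <= u]) => [z _|].
  exact: continuous_circle_cos.
exact: closed_ge.
Qed.

(** Every point of [K] has a null open neighbourhood, and by compactness finitely many of them cover
    [K]. *)
Lemma compl_support_null (mu : {measure set (circle R) -> \bar R})
  (K : set (circle R)) :
  closed K -> K `&` measure_support mu = set0 -> mu K = 0%E.
Proof.
move=> cK K0; have := closed_compact_circle cK; rewrite compact_cover.
pose D := [set U : set (circle R) | open U /\ mu U = 0%E].
move=> /(_ _ D id) [|z Kz|D' D'D KD'].
- by move=> U [].
- have : ~ measure_support mu z by move=> sz; rewrite -[False]/(set0 z) -K0.
  move=> /existsNP[U /not_implyP[oU /not_implyP[Uz]]] /negP; rewrite -leNgt => U0.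
  exists U => //; split => //; apply/eqP; rewrite eq_le U0/=; exact: measure_ge0.
have D'P (U : set (circle R)) : [set` D'] U -> open U /\ mu U = 0%E.
  by move=> /= UD'; have := D'D _ UD'; rewrite inE.
have fD' := finite_fset D'.
have mD' U : [set` D'] U -> measurable U.
  by move=> /D'P[oU _]; exact: measurable_open_circle.
have := content_sub_fsum mu fD' mD' (measurable_closed_circle cK) KD'.
rewrite fsbig1 => [h|U /D'P[] //].
by apply/eqP; rewrite eq_le h; exact: measure_ge0.
Qed.
End Circle.

(** * Measures with a density *)

Section Density.
Context {d1 d2} {T1 : measurableType d1} {T2 : measurableType d2} {R : realType}.
Variables (mu : {measure set T1 -> \bar R}) (D : set T1) (phi : T1 -> T2) (g : T1 -> R).
Hypotheses (mD : measurable D) (finD : (mu D < +oo)%E).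
Hypotheses (mphi : measurable_fun setT phi) (bg : bounded_measurable D g).
Hypothesis g0 : forall t, D t -> 0 <= g t.
Local Open Scope ereal_scope.

Let fill (A : set T2) : \bar R := \int[mu]_(t in D) (g t * \1_A (phi t))%:E.

(* Zero on non-measurable sets, as required by pair_measure_borel. *)
Definition push_density (A : set T2) : \bar R :=
  if `[< measurable A >] then fill A else 0.

Let mgA (A : set T2) : measurable A ->
  measurable_fun D (fun t => (g t * \1_A (phi t))%:E).
Proof.
move=> mA; apply/measurable_EFinP; apply: measurable_funM; first by case: bg.
apply: measurable_funTS; apply: (@measurableT_comp _ _ _ _ _ _ (\1_A : T2 ->
  R) _ phi) => //.
Qed.

Let gA0 (A : set T2) t : D t -> 0 <= (g t * \1_A (phi t))%:E.
Proof. by move=> Dt; rewrite lee_fin mulr_ge0 ?g0. Qed.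

Let push_density0 : push_density set0 = 0.
Proof.
rewrite /push_density asboolT// /fill.
by under eq_integral do rewrite indic0 mulr0; rewrite integral0.
Qed.

Let push_density_ge0 A : 0 <= push_density A.
Proof.
rewrite /push_density; case: ifP => // _.
by apply: integral_ge0 => t Dt; exact: gA0.
Qed.

Let push_density_sigma_additive : semi_sigma_additive push_density.
Proof.
move=> F mF tF mUF; rewrite /push_density (asboolT mUF).
under eq_fun do under eq_bigr do rewrite (asboolT (mF _)).
have -> : fill (\bigcup_n F n) = \sum_(0 <= n <oo) fill (F n).
  rewrite /fill -integral_nneseries//; last 2 first.
  - by move=> n; exact: mgA.
  - by move=> n t Dt; exact: gA0.
  apply: eq_integral => t; rewrite inE => Dt.
  under eq_eseriesr do rewrite EFinM.
  rewrite nneseriesZl; last by move=> n _; rewrite lee_fin.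
  by rewrite EFinM indic_bigcup.
apply: is_cvg_nneseries => n _ _; apply: integral_ge0 => t Dt; exact: gA0.
Qed.

HB.instance Definition _ := isMeasure.Build _ _ _ push_density
  push_density0 push_density_ge0 push_density_sigma_additive.

Let push_density_fin : fin_num_fun push_density.
Proof.
have [mg [B gB]] := bg.
move=> A mA; rewrite ge0_fin_numE// /push_density asboolT// /fill.
have : mu.-integrable D (fun t => (g t * \1_A (phi t))%:E).
  apply: (@bounded_measurable_integrable _ _ _ mu D mD finD (fun t => (g t * \1_A (phi t))%R)).
  split; first by apply/measurable_EFinP; exact: mgA.
  exists B => t Dt; rewrite normrM; apply: le_trans (gB t Dt).
  by rewrite ler_piMr// indicE; case: (_ \in _); rewrite ?normr1 ?normr0.
move=> /integrableP[_]; apply: le_lt_trans; apply: ge0_le_integral => //.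
- by move=> t Dt; exact: gA0.
- exact: mgA.
- by apply: measurableT_comp => //; exact: mgA.
- by move=> t Dt; rewrite lee_abs.
Qed.

HB.instance Definition _ := Measure_isFinite.Build _ _ _ push_density push_density_fin.

Lemma push_density_not_measurable A : ~ measurable A -> push_density A = 0.
Proof. by move=> mA; rewrite /push_density asboolF. Qed.

Definition push_density_measure : {finite_measure set T2 -> \bar R} := push_density.

Lemma push_density_null A : measurable A -> (forall t, D t -> A (phi t) -> g t = 0%R) ->
  push_density_measure A = 0.
Proof.
move=> mA gA; rewrite /= /push_density asboolT// /fill -[RHS](integral0 mu D).
apply: eq_integral => t; rewrite inE => Dt; rewrite indicE.
by have [|] := boolP (phi t \in A); [rewrite inE => /(gA _ Dt) ->;
  rewrite mul0r|rewrite mulr0].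
Qed.

Import HBNNSimple.

Let integral_nnsfun_push_density (h : {nnsfun T2 >-> R}) :
  \int[push_density]_z (h z)%:E = \int[mu]_(t in D) (h (phi t) * g t)%:E.
Proof.
rewrite integralT_nnsfun sintegralE.
transitivity (\int[mu]_(t in D) \sum_(x \in range h)
    (x * (g t * \1_(h @^-1` [set x]) (phi t)))%:E); last first.
  apply: eq_integral => t _; rewrite fsumEFin//; congr EFin.
  rewrite [in RHS](fimfunE h) fsbig_finite//= [in RHS]fsbig_finite//= mulr_suml.
  by apply: eq_bigr => x _; rewrite mulrCA mulrC -mulrA.
have mh x : measurable (h @^-1` [set x]) by exact: measurable_sfunP.
rewrite ge0_integral_fsum//; last 2 first.
- by move=> x; under eq_fun do rewrite EFinM; apply: emeasurable_funM => //; exact: mgA.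
- move=> x t Dt; have [x0|x0] := leP 0%R x; first
  by rewrite lee_fin mulr_ge0// mulr_ge0 ?g0.
  rewrite preimage_nnfun0// indic0 !mulr0//.
apply: eq_fsbigr => x; rewrite inE => -[z _ <-].
under eq_integral do rewrite EFinM.
rewrite ge0_integralZl//; last 3 first.
- exact: mgA.
- by move=> t Dt; exact: gA0.
- by rewrite lee_fin.
by rewrite /= /push_density asboolT.
Qed.

Lemma ge0_integral_push_density (f : T2 -> R) : measurable_fun setT f ->
  (forall z, 0 <= f z)%R ->
  \int[push_density]_z (f z)%:E = \int[mu]_(t in D) (f (phi t) * g t)%:E.
Proof.
move=> mf f0; have mEf : measurable_fun setT (EFin \o f) by exact/measurable_EFinP.
pose h := nnsfun_approx measurableT mEf.
have hf z : (fun n => (h n z)%:E) @ \oo --> (f z)%:E.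
  by apply: (@cvg_nnsfun_approx _ _ _ setT measurableT (EFin \o f) mEf) => // y _;
    rewrite lee_fin.
have hn z : {homo (fun n => h n z) : a b / (a <= b)%N >-> (a <= b)%R}.
  by move=> a b ab; exact/lefP/nd_nnsfun_approx.
have e1 : \int[push_density]_z (f z)%:E =
  limn (fun n => \int[push_density]_z (h n z)%:E).
  rewrite -monotone_convergence//.
  - by apply: eq_integral => z _; apply/esym/cvg_lim => //; exact: hf.
  - by move=> n; apply/measurable_EFinP.
  - by move=> n z _; rewrite lee_fin.
  - by move=> z _ a b ab; rewrite lee_fin hn.
have e2 : \int[mu]_(t in D) (f (phi t) * g t)%:E =
    limn (fun n => \int[mu]_(t in D) (h n (phi t) * g t)%:E).
  rewrite -monotone_convergence//.
  - apply: eq_integral => t _; apply/esym/cvg_lim => //.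
    under eq_fun do rewrite EFinM; rewrite EFinM.
    by apply: cvgeZr => //; exact: hf.
  - move=> n; apply/measurable_EFinP; apply: measurable_funM; last by case: bg.
    by apply: measurable_funTS; apply: (@measurableT_comp _ _ _ _ _ _ (h n) _ phi).
  - by move=> n t Dt; rewrite lee_fin mulr_ge0 ?g0.
  - by move=> t Dt a b ab; rewrite lee_fin ler_wpM2r ?g0// hn.
rewrite e1 e2; congr (limn _); apply/funext => n.
exact: integral_nnsfun_push_density.
Qed.

Lemma Rintegral_push_density (f : T2 -> R) : bounded_measurable setT f ->
  (\int[push_density_measure]_z f z = \int[mu]_(t in D) (f (phi t) * g t))%R.
Proof.
rewrite /push_density_measure/=; move=> bf; have [mf [C fC]] := bf; pose B := `|C|%R.
have fB z : setT z -> (`|f z| <= B)%R by move=> /fC /le_trans; apply; exact: ler_norm.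
have bB (r : R) : bounded_measurable [set: T2] (fun=> r) := bounded_measurable_cst setT r.
have finT : (push_density setT < +oo)%E by rewrite -ge0_fin_numE// push_density_fin.
(* Reduction to nonnegative functions: the formula holds for [f + B] and for the constant [B], whose
   contribution then cancels. *)
have fB0 z : (0 <= f z + B)%R by have := fB z I; rewrite ler_norml; lra.
have bfphi : bounded_measurable D (fun t => f (phi t)).
  split; last by exists B => t _; exact: fB.
  by apply: measurable_funTS; exact: (@measurableT_comp _ _ _ _ _ _ f _ phi).
have ge0E (u : T2 -> R) : measurable_fun setT u -> (forall z, 0 <= u z)%R ->
    (\int[push_density]_z u z = \int[mu]_(t in D) (u (phi t) * g t))%R.
  by move=> mu_ u0; rewrite /Rintegral ge0_integral_push_density.
have := ge0E (fun z => f z + B)%R (measurable_funD mf (measurable_cst B)) fB0.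
rewrite (bm_RintegralD measurableT finT bf (bB B)).
under [X in _ = X -> _]eq_Rintegral do rewrite mulrDl.
rewrite (bm_RintegralD mD finD); last 2 first.
- exact: bounded_measurableM.
- by apply: bounded_measurableM => //; exact: bounded_measurable_cst.
have <- := ge0E (fun=> B) (measurable_cst B) (fun=> normr_ge0 _).
by move/addIr.
Qed.

End Density.

(** * Fourier coefficients and the weighted norm *)

Section Fourier.
Context {R : realType}.
Implicit Types (mu nu : {finite_measure set (circle R) -> \bar R}) (n : int).

Definition cos_coef (mu : {measure set (circle R) -> \bar R}) (n : nat) : R :=
  \int[mu]_z circle_cos n z.
Definition sin_coef (mu : {measure set (circle R) -> \bar R}) (n : nat) : R :=
  \int[mu]_z circle_sin n z.

Lemma fin_measureT mu : (mu setT < +oo)%E.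
Proof. by rewrite -ge0_fin_numE// fin_num_measure. Qed.

Lemma circle_expVn (z : circle R) (m : nat) :
  (val z ^+ m)^-1 = (circle_cos m z +i* - circle_sin m z)%C.
Proof.
have [t _ ->] := turn_surj z; rewrite circle_cos_turn circle_sin_turn val_turnX.
apply: mulr1_eq; set a := cos _; set b := sin _.
have ab : a ^+ 2 + b ^+ 2 = 1 by exact: cos2Dsin2.
by congr Complex; [rewrite -ab; ring|ring].
Qed.

Definition sgn_coef n : R := if n is Posz _ then -1 else 1.

Lemma sgn_coef_sqr n : sgn_coef n ^+ 2 = 1.
Proof. by case: n => m /=; rewrite ?sqrrN expr1n. Qed.

Lemma fourierE mu n :
  fourier mu n = (cos_coef mu `|n| +i* (sgn_coef n * sin_coef mu `|n|))%C.
Proof.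
rewrite /fourier /cos_coef /sin_coef.
case: n => [m|m] /=.
  have E (z : circle R) : val z ^ (- Posz m) = (circle_cos m z +i* - circle_sin m z)%C.
    by rewrite -circle_expVn exprnN.
  under eq_Rintegral do rewrite E.
  under [X in Complex _ X]eq_Rintegral do rewrite E.
  by rewrite /= (bm_RintegralN measurableT (fin_measureT mu) (bm_circle_sin m)) mulN1r.
rewrite mul1r; congr Complex; apply: eq_Rintegral => z _;
  by rewrite NegzE opprK.
Qed.

(** The measure being real, the coefficients at [n] and [-n] are conjugate, so the estimates can be
    made on real sequences indexed by [nat]. *)
Lemma normc_fourier mu n :
  Normc.normc (fourier mu n) ^+ 2 = cos_coef mu `|n| ^+ 2 + sin_coef mu `|n| ^+ 2.
Proof.
rewrite fourierE /= sqr_sqrtr ?addr_ge0 ?sqr_ge0//.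
by rewrite exprMn sgn_coef_sqr mul1r.
Qed.

Lemma normc_fourierB mu nu n :
  Normc.normc (fourier mu n - fourier nu n) ^+ 2 =
  (cos_coef mu `|n| - cos_coef nu `|n|) ^+ 2 + (sin_coef mu `|n| - sin_coef nu `|n|) ^+ 2.
Proof.
rewrite !fourierE /= sqr_sqrtr ?addr_ge0 ?sqr_ge0//.
by rewrite -mulrBr exprMn sgn_coef_sqr mul1r.
Qed.

Lemma norm_cos_coef_le mu (n : nat) : `|cos_coef mu n| <= fine (mu setT).
Proof.
rewrite -[leRHS]mul1r.
apply: (normr_Rintegral_le measurableT (fin_measureT mu) (bm_circle_cos n)) => z _.
exact: norm_circle_cos.
Qed.

Lemma norm_sin_coef_le mu (n : nat) : `|sin_coef mu n| <= fine (mu setT).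
Proof.
rewrite -[leRHS]mul1r.
apply: (normr_Rintegral_le measurableT (fin_measureT mu) (bm_circle_sin n)) => z _.
exact: norm_circle_sin.
Qed.

Variable w : nat -> {posnum R}.

(** The factor 2 accounts for [n] and [-n]; each half is bounded by the full sum over [nat]. As
    [Negz m] is [-(m + 1)], the negative half uses the partial sum up to [L.+1]. *)
Lemma ell2_sqnorm_le (a : int -> R[i]) (b : nat -> R) (e : R) :
  (forall n : int, Normc.normc (a n) ^+ 2 <= b `|n|%N) ->
  (forall L, \sum_(0 <= n < L) b n * (w n)%:num <= e) ->
  (ell2_sqnorm w a <= (2 * e)%:E)%E.
Proof.
move=> ab be; have b0 (n : nat) : 0 <= b n.
  by apply: le_trans (ab (Posz n)); exact: sqr_ge0.
have bw0 (n : nat) : (0 <= (b n * (w n)%:num)%:E)%E by rewrite lee_fin mulr_ge0.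
have lim_le (c : nat -> \bar R) (e' : R) : (forall n : nat, 0 <= c n)%E ->
    (forall L, \sum_(0 <= n < L) c n <= e'%:E)%E -> (\esum_(n in [set: nat]) c n <=
      e'%:E)%E.
  move=> c0 ce; rewrite -nneseries_esumT//; apply: lime_le.
    by apply: is_cvg_nneseries => n _ _; exact: c0.
  exact: nearW.
have E : (ell2_sqnorm w a <=
    \esum_(n in [set: int]) (b `|n|%N * (w `|n|%N)%:num)%:E)%E.
  by apply: le_esum => n _; rewrite lee_fin ler_wpM2r.
apply: le_trans E _; rewrite (esumID (range Posz)); last first.
  by move=> n _; exact: bw0.
rewrite setTI (_ : [set: int] `&` ~` range Posz = range Negz); last first.
  apply/seteqP; split => [[m [_ []]|m _]|_ [m _ <-]].
  - by exists m.
  - by exists m.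
  - by split => // -[k _].
rewrite !esum_image; [|by move=> x y _ _ []..].
rewrite mulr2n mulrDl mul1r EFinD; apply: leeD; apply: lim_le => // L.
  by rewrite sumEFin lee_fin.
rewrite sumEFin lee_fin; apply: le_trans (be L.+1).
by rewrite [leRHS]big_nat_recl//= lerDr mulr_ge0.
Qed.

Definition ell2_term (mu : {measure set (circle R) -> \bar R}) (n : nat) : R :=
  (cos_coef mu n ^+ 2 + sin_coef mu n ^+ 2) * (w n)%:num.

Lemma ell2_term_ge0 (mu : {measure set (circle R) -> \bar R}) (n : nat) : 0 <=
  ell2_term mu n.
Proof. by rewrite mulr_ge0// addr_ge0 ?sqr_ge0. Qed.

Lemma ell2_term_summable mu : ell2 w (fourier mu) ->
  exists S, forall L, \sum_(0 <= n < L) ell2_term mu n <= S.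
Proof.
move=> l2; exists (fine (ell2_sqnorm w (fourier mu))) => L.
have fin : ell2_sqnorm w (fourier mu) \is a fin_num.
  by rewrite ge0_fin_numE// ell2_sqnorm_ge0.
rewrite -lee_fin fineK// -sumEFin.
have E : (\esum_(n in range Posz)
  (Normc.normc (fourier mu n) ^+ 2 * (w `|n|%N)%:num)%:E <=
    ell2_sqnorm w (fourier mu))%E.
  rewrite /ell2_sqnorm [leRHS](esumID (range Posz)).
    rewrite setTI leeDl//; apply: esum_ge0 => n _.
    by rewrite lee_fin mulr_ge0// sqr_ge0.
  by move=> n _; rewrite lee_fin mulr_ge0// sqr_ge0.
apply: le_trans E; rewrite esum_image; last by move=> x y _ _ [].
rewrite -nneseries_esumT; last by move=> n; rewrite lee_fin mulr_ge0// sqr_ge0.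
under [X in (_ <= X)%E]eq_eseriesr do rewrite normc_fourier.
by apply: nneseries_lim_ge => n _ _; rewrite lee_fin ell2_term_ge0.
Qed.

End Fourier.

(** * Estimates for weighted sums *)

Section RealSums.
Context {R : realType}.

Lemma nneg_sum_tail (v : nat -> R) (S e : R) : (forall n, 0 <= v n) ->
  (forall L, \sum_(0 <= n < L) v n <= S) -> 0 < e ->
  exists M : nat, forall L, \sum_(M <= n < L) v n <= e.
Proof.
move=> v0 vS e0.
have nd : nondecreasing_seq (series v) by apply: nondecreasing_series => n _ _.
have cv : cvgn (series v).
  by apply: nondecreasing_is_cvgn => //; exists S => _ [L _ <-]; exact: vS.
have /cvgrPdist_lt/(_ e e0)[M _ HM] := cv.
exists M => L; have [LM|/ltnW ML] := leqP L M.
  by rewrite big_geq// ltW.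
have -> : \sum_(M <= n < L) v n = series v L - series v M.
  by rewrite /series/= [X in _ = X - _](big_cat_nat _ ML)//= addrAC subrr add0r.
have h1 := nondecreasing_cvgn_le nd cv L.
have := HM M (leqnn M); rewrite /= ger0_norm ?subr_ge0;
  last exact: nondecreasing_cvgn_le.
lra.
Qed.

(** Low frequencies use that [1 - c n] is small with [h], high ones that the tail of [v] is small.
    The threshold [h0] is uniform in [c], since a kernel is chosen only after its width. *)
Lemma multiplier_sum_le (v : nat -> R) (S e : R) : (forall n, 0 <= v n) ->
  (forall L, \sum_(0 <= n < L) v n <= S) -> 0 < e ->
  exists2 h0 : R, 0 < h0 & forall (h : R) (c : nat -> R), 0 < h <= h0 ->
    (forall n, `|1 - c n| <= 2 * (n%:R * h) ^+ 2) -> (forall n, `|c n| <= 1) ->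
    forall L, \sum_(0 <= n < L) (1 - c n) ^+ 2 * v n <= e.
Proof.
move=> v0 vS e0; have e8 : 0 < e / 8 by rewrite divr_gt0.
have [M HM] := nneg_sum_tail v0 vS e8.
have S0 : 0 <= S by have := vS 0%N; rewrite big_geq.
(* The head is at most [4 * M ^ 2 * h * S], which [h <= e / Q] brings below [e / 2]; the 1 keeps [Q]
   positive. *)
pose Q := 8 * M%:R ^+ 2 * S + 1.
have Q0 : 0 < Q by rewrite ltr_wpDl// mulr_ge0// mulr_ge0// sqr_ge0.
exists (Num.min 1 (e / Q)); first by rewrite lt_min ltr01 divr_gt0.
move=> h c /andP[h0]; rewrite le_min => /andP[h1 he] c1 c2 L.
have c4 n : (1 - c n) ^+ 2 <= 4.
  by have := c2 n; rewrite ler_norml; nra.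
have cM n : (n < M)%N -> (1 - c n) ^+ 2 <= 4 * (M%:R ^+ 2 * h).
  move=> nM; have nM' : n%:R <= M%:R :> R by rewrite ler_nat ltnW.
  have n0 : 0 <= n%:R :> R by [].
  have a2 : `|1 - c n| <= 2 by have := c2 n; rewrite ler_norml ler_norml; lra.
  have -> : (1 - c n) ^+ 2 = `|1 - c n| ^+ 2 by rewrite real_normK ?num_real.
  apply: (@le_trans _ _ (2 * `|1 - c n|)); first by rewrite expr2 ler_wpM2r.
  apply: (@le_trans _ _ (2 * (2 * (n%:R * h) ^+ 2))); first by rewrite ler_wpM2l.
  have -> : 2 * (2 * (n%:R * h) ^+ 2) = 4 * (n%:R ^+ 2 * (h * h)) by ring.
  rewrite ler_wpM2l// ler_pM ?sqr_ge0 ?mulr_ge0 ?(ltW h0)//.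
    by rewrite lerXn2r// nnegrE.
  by rewrite ler_piMr// ltW.
have head K : (K <= M)%N -> \sum_(0 <= n < K) (1 - c n) ^+ 2 * v n <= e / 2.
  move=> KM; apply: (@le_trans _ _ (4 * (M%:R ^+ 2 * h) * \sum_(0 <= n < K) v n)).
    rewrite mulr_sumr !big_nat; apply: ler_sum => n /andP[_ nK].
    by rewrite ler_wpM2r// cM// (leq_trans nK).
  apply: (@le_trans _ _ (4 * (M%:R ^+ 2 * h) * S)).
    by rewrite ler_wpM2l// mulr_ge0// mulr_ge0 ?sqr_ge0// ltW.
  move: he; rewrite ler_pdivlMr// /Q => he.
  have MS : 0 <= M%:R ^+ 2 * S by rewrite mulr_ge0// sqr_ge0.
  nra.
have [LM|/ltnW ML] := leqP L M.
  by apply: le_trans (head _ LM) _; lra.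
rewrite (big_cat_nat _ ML)//=.
have := head _ (leqnn M).
suff : \sum_(M <= n < L) (1 - c n) ^+ 2 * v n <= e / 2 by lra.
apply: (@le_trans _ _ (4 * \sum_(M <= n < L) v n)).
  by rewrite mulr_sumr; apply: ler_sum => n _; rewrite ler_wpM2r.
by have := HM L; lra.
Qed.

Local Notation gap n M := ((n - M) + (M - n))%N.

(** Each value of the gap is attained at most twice, once on each side of [M], and each side is a
    sum of inverse squares. *)
Lemma sum_gap_le (M L : nat) :
  \sum_(0 <= n < L) ((gap n M).+1%:R : R) ^- 2 <= 4.
Proof.
have [LM|/ltnW ML] := leqP L M.
  apply: (@le_trans _ _ (\sum_(0 <= n < M.+1) ((gap n M).+1%:R : R) ^- 2)).
    rewrite [leRHS](@big_cat_nat _ _ _ L)//=; last exact: leqW.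
    by rewrite lerDl sumr_ge0// => i _; rewrite invr_ge0 sqr_ge0.
  apply: (@le_trans _ _ 2) => //; last by lra.
  rewrite big_nat_rev/=; apply: le_trans (sum_inv_sqr_le M.+1).
  rewrite !big_nat; apply: ler_sum => n /andP[_ nM].
  by rewrite (_ : gap (0 + M.+1 - n.+1) M = n)//; lia.
rewrite (big_cat_nat _ ML)//= (_ : 4 = 2 + 2); last by ring.
apply: lerD.
  rewrite big_nat_rev/=; apply: le_trans (sum_inv_sqr_le M).
  rewrite !big_nat; apply: ler_sum => n /andP[_ nM].
  rewrite lef_pV2 ?posrE ?exprn_gt0// lerXn2r ?nnegrE// ler_nat; lia.
rewrite -{1}[M]add0n big_addn; apply: le_trans (sum_inv_sqr_le (L - M)).
apply: ler_sum => n _.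
by rewrite (_ : gap (n + M) M = n)//; lia.
Qed.

(* Multiplying by a cosine series in N t shifts frequencies by the multiples of N.
   After weighting, the k-th shift contributes at most
   x n k = (1 + k)^-2 (1 + |n - k N|)^-2 to the n-th coefficient. The sum of x n k
   over k is bounded, so its square is at most a constant times itself, and the
   double sum of x n k is finite. *)
Lemma modulation_sum_le (w : nat -> {posnum R}) (A N : nat) (e K : R)
    (D : nat -> R) (s : nat -> nat -> R) :
  0 <= e -> 0 <= K ->
  (forall k n, (0 < k)%N -> (w n)%:num <= e ^+ 2 *
      ((1 + gap n (k * N))%N%:R * (1 + k)%N%:R) ^+ (2 * A)) ->
  (forall n, s n @ \oo --> D n) ->
  (forall n L, `|s n L| <= \sum_(0 <= k < L)
     K / ((gap n (k.+1 * N)).+1%:R * k.+2%:R) ^+ (A + 2)) ->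
  forall L, \sum_(0 <= n < L) D n ^+ 2 * (w n)%:num <= 16 * (e * K) ^+ 2.
Proof.
move=> e0 K0 wP sD sK L'.
pose x n k : R := (k.+1%:R) ^- 2 * ((gap n (k.+1 * N)).+1%:R) ^- 2.
have x0 n k : 0 <= x n k by rewrite mulr_ge0// invr_ge0 sqr_ge0.
have eK : 0 <= e * K by rewrite mulr_ge0.
have sw n L : `|s n L| * Num.sqrt (w n)%:num <= e * K * \sum_(0 <= k < L) x n k.
  apply: (@le_trans _ _ (\sum_(0 <= k < L)
     K / ((gap n (k.+1 * N)).+1%:R * k.+2%:R) ^+ (A + 2) * Num.sqrt (w n)%:num)).
    by rewrite -mulr_suml ler_wpM2r ?sqrtr_ge0.
  rewrite mulr_sumr; apply: ler_sum => k _.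
  set d := gap n (k.+1 * N); set X : R := d.+1%:R * k.+2%:R.
  have X0 : 0 < X by rewrite mulr_gt0.
  (* The square root halves the exponent [2 * A], so a factor [X ^- 2] of the decay [X ^- (A + 2)]
     is left for summation. *)
  have wX : Num.sqrt (w n)%:num <= e * X ^+ A.
    rewrite -[leRHS]ger0_norm ?mulr_ge0 ?exprn_ge0 ?(ltW X0)// -sqrtr_sqr.
    apply: ler_wsqrtr; apply: le_trans (wP k.+1 n isT) _.
    have -> : (e * X ^+ A) ^+ 2 = e ^+ 2 * X ^+ (2 * A)
      by rewrite exprMn -exprM (mulnC A).
    by rewrite /X !add1n.
  apply: (@le_trans _ _ (K / X ^+ (A + 2) * (e * X ^+ A))).
    by rewrite ler_wpM2l// mulr_ge0// invr_ge0 exprn_ge0// ltW.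
  have -> : K / X ^+ (A + 2) * (e * X ^+ A) = e * K * X ^- 2.
    rewrite exprD; field.
    by rewrite !expf_neq0// gt_eqF.
  rewrite ler_wpM2l// /x /X exprMn invfM mulrC ler_wpM2r ?invr_ge0 ?sqr_ge0//.
  by rewrite lef_pV2 ?posrE ?exprn_gt0// lerXn2r ?nnegrE// ler_nat.
have xs n L : \sum_(0 <= k < L) x n k <= 2.
  apply: le_trans (sum_inv_sqr_le L); apply: ler_sum => k _.
  by rewrite ler_piMr ?invr_ge0 ?sqr_ge0// invf_le1 ?exprn_gt0// exprn_ege1// ler1n.
have sq n L : s n L ^+ 2 * (w n)%:num <= (e * K) ^+ 2 * 2 * \sum_(0 <= k < L) x n k.
  have S0 : 0 <= \sum_(0 <= k < L) x n k by rewrite sumr_ge0.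
  apply: (@le_trans _ _ ((`|s n L| * Num.sqrt (w n)%:num) ^+ 2)).
    by rewrite exprMn sqr_sqrtr// real_normK ?num_real.
  apply: (@le_trans _ _ ((e * K * \sum_(0 <= k < L) x n k) ^+ 2)).
    by rewrite lerXn2r ?nnegrE ?mulr_ge0 ?sqrtr_ge0// sw.
  rewrite exprMn -mulrA ler_wpM2l ?sqr_ge0// expr2 ler_wpM2r//.
(* The 16 is 2 from [sq] times [2 * 4] from the double sum, taken over [n] first. *)
have tot L : \sum_(0 <= n < L') s n L ^+ 2 * (w n)%:num <= 16 * (e * K) ^+ 2.
  apply: (@le_trans _ _ (\sum_(0 <= n < L') (e * K) ^+ 2 * 2 * \sum_(0 <=
    k < L) x n k)).
    by apply: ler_sum => n _; exact: sq.
  rewrite -mulr_sumr exchange_big/=.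
  have : \sum_(0 <= k < L) \sum_(0 <= n < L') x n k <= 2 * 4.
    apply: (@le_trans _ _ (\sum_(0 <= k < L) (k.+1%:R : R) ^- 2 * 4)).
      apply: ler_sum => k _; rewrite /x -mulr_sumr ler_wpM2l ?invr_ge0 ?sqr_ge0//.
      exact: sum_gap_le.
    by rewrite -mulr_suml ler_wpM2r// sum_inv_sqr_le.
  have : 0 <= (e * K) ^+ 2 by exact: sqr_ge0.
  by move: (_ ^+ 2) (\sum_(_ <= _ < _) _) => u v; nra.
(* As [tot] is uniform in [L], the limit in [L] is taken with [L'] fixed and no infinite sums are
   exchanged. *)
have lim : (fun L => \sum_(0 <= n < L') s n L ^+ 2 * (w n)%:num) @ \oo -->
    \sum_(0 <= n < L') D n ^+ 2 * (w n)%:num.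
  elim: L' {tot} => [|L' IH].
    by rewrite big_geq//; under eq_fun do rewrite big_geq//; exact: cvg_cst.
  rewrite big_nat_recr//=; under eq_fun do rewrite big_nat_recr//=.
  apply: cvgD => //; apply: cvgM; last exact: cvg_cst.
  by rewrite expr2; under eq_fun do rewrite expr2; apply: cvgM.
rewrite -(cvg_lim _ lim)//; apply: limr_le; first by apply/cvg_ex; eexists; exact: lim.
by apply: nearW => L; exact: tot.
Qed.

End RealSums.

(** * Smoothing and modulation *)

Section Modulation.
Context {R : realType}.
Local Notation mu := (@lebesgue_measure R).
Local Notation I01 := (`[0%R, 1%R]%classic : set R).
Local Notation gap n M := ((n - M) + (M - n))%N.

Lemma kernel_decay_le q p h (b : nat -> R) Psi : (q <= p)%N ->
  smooth_kernel p h b Psi ->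
  exists2 K, 0 <= K & forall m, `|b m| <= K / m.+1%:R ^+ q.
Proof.
move=> qp kQ; have [K bK] := kernel_decay kQ.
have K0 : 0 <= K by have := le_trans (normr_ge0 _) (bK 0%N); rewrite expr1n divr1.
exists K => // m; apply: le_trans (bK m) _.
rewrite ler_wpM2l// lef_pV2 ?posrE ?exprn_gt0//.
by apply: ler_weXn2l => //; rewrite ler1n.
Qed.

Lemma bm_kernel_scale p h (b : nat -> R) Psi (N : nat) : (2 <= p)%N ->
  smooth_kernel p h b Psi -> bounded_measurable I01 (fun t => Psi (N%:R * t)).
Proof.
move=> p2 kQ; have [S bS] := kernel_summable p2 kQ.
have mc k : measurable_fun I01 (fun t : R => cos (2 * pi * k%:R * (N%:R * t))).
  have -> : (fun t : R => cos (2 * pi * k%:R * (N%:R * t))) =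
      (fun t : R => cos (2 * pi * k%:R * N%:R * t)).
    by apply/funext => t; rewrite mulrA.
  by case: (bounded_measurable_cos_mul I01 (2 * pi * k%:R * N%:R)).
apply: (bounded_measurable_series bS mc) => [k t _|t _]; first exact: cos_max.
exact: (kernel_series kQ).
Qed.

(* T n stands for the n-th cosine or the n-th sine. *)
Lemma modulation_coef_le (w : nat -> {posnum R}) (A N : nat) (e K1 Kb : R)
    p h (b : nat -> R) Psi (f : R -> R) (T : nat -> R -> R) :
  0 <= e -> 0 <= K1 -> 0 <= Kb -> (2 <= p)%N -> smooth_kernel p h b Psi ->
  (forall k n, (0 < k)%N -> (w n)%:num <= e ^+ 2 *
      ((1 + gap n (k * N))%N%:R * (1 + k)%N%:R) ^+ (2 * A)) ->
  (forall m, `|b m| <= Kb / m.+1%:R ^+ (A + 2)) ->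
  bounded_measurable I01 f -> (forall n, bounded_measurable I01 (T n)) ->
  (forall n M, exists2 s, `|s| <= 1 & forall t,
    cos (2 * pi * M%:R * t) * T n t = (T (n + M)%N t + s * T (gap n M) t) / 2) ->
  (forall n, `|\int[mu]_(t in I01) (f t * T n t)| <= K1 / n.+1%:R ^+ (A + 2)) ->
  forall L, \sum_(0 <= n < L)
    (\int[mu]_(t in I01) (f t * Psi (N%:R * t) * T n t) -
     \int[mu]_(t in I01) (f t * T n t)) ^+ 2 * (w n)%:num <= 16 * (e * (Kb * K1)) ^+ 2.
Proof.
move=> e0 K10 Kb0 p2 kQ wP bK bf bT TT fT.
pose u k t : R := cos (2 * pi * k%:R * (N%:R * t)).
pose I n k := \int[mu]_(t in I01) (u k t * (f t * T n t)).
have uE k t : u k t = cos (2 * pi * (k * N)%N%:R * t) by rewrite /u natrM !mulrA.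
have bu k : bounded_measurable I01 (u k).
  by rewrite (funext (uE k)); exact: bounded_measurable_cos_mul.
apply: (@modulation_sum_le _ w A N e (Kb * K1) _
  (fun n L => \sum_(0 <= k < L) b k.+1 * I n k.+1)) => //.
- by rewrite mulr_ge0.
- move=> n; have [S bS] := kernel_summable p2 kQ.
  have H := cvg_Rintegral_series measurable01 lebesgue01_fin bS (fun k => (bu k).1)
    (fun k t _ => cos_max _) (fun t _ => @kernel_series _ _ _ _ _ kQ (N%:R * t))
    (bounded_measurableM bf (bT n)).
  have {}H : (fun L => \sum_(0 <= k < L.+1) b k * I n k) @ \oo -->
      \int[mu]_(t in I01) (f t * Psi (N%:R * t) * T n t).
    have -> : \int[mu]_(t in I01) (f t * Psi (N%:R * t) * T n t) =
        \int[mu]_(t in I01) (Psi (N%:R * t) * (f t * T n t)).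
      by apply: eq_Rintegral => t _; ring.
    by move: H; rewrite -(cvg_shiftS _ _).
  (* The term [k = 0] is the coefficient of [f] itself, because [b 0 = 1]; subtracting it leaves
     only genuine shifts. *)
  have I0 : I n 0%N = \int[mu]_(t in I01) (f t * T n t).
    by apply: eq_Rintegral => t _; rewrite /u mulr0 mul0r cos0 mul1r.
  rewrite -I0; rewrite [X in X @ _](_ : _ = (fun L => \sum_(0 <=
    k < L.+1) b k * I n k - I n 0%N)).
    by apply: cvgB => //; exact: cvg_cst.
  apply/funext => L; rewrite big_nat_recl//= (kernel_coef0 kQ) mul1r addrAC subrr add0r.
  by [].
- move=> n L; apply: le_trans (ler_norm_sum _ _ _) _; apply: ler_sum => k _.
  set M := (k.+1 * N)%N; set d := gap n M.
  have [s s1 sE] := TT n M.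
  have IE : I n k.+1 = (\int[mu]_(t in I01) (f t * T (n + M)%N t) +
      s * \int[mu]_(t in I01) (f t * T d t)) / 2.
    rewrite /I -Rintegral01Zl; last exact: bounded_measurableM.
    rewrite -Rintegral01D; [|by solve_bm..].
    rewrite mulrC -Rintegral01Zl; last by solve_bm.
    by apply: eq_Rintegral => t _; rewrite uE mulrCA sE; field.
  have I1 : `|I n k.+1| <= K1 / d.+1%:R ^+ (A + 2).
    (* The frequency [n + M] is at least the gap [d], so the bound at [d] holds for it too. *)
    have h1 : `|\int[mu]_(t in I01) (f t * T (n + M)%N t)| <= K1 / d.+1%:R ^+ (A + 2).
      apply: le_trans (fT _) _; rewrite ler_wpM2l// lef_pV2 ?posrE ?exprn_gt0//.
      by rewrite lerXn2r ?nnegrE// ler_nat /d; lia.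
    have h2 : `|s * \int[mu]_(t in I01) (f t * T d t)| <= K1 / d.+1%:R ^+ (A + 2).
      by rewrite normrM; apply: le_trans (fT d); rewrite ler_piMl.
    rewrite IE normrM normfV normr_nat ler_pdivrMr//.
    by apply: le_trans (ler_normD _ _) _; lra.
  rewrite normrM exprMn invfM.
  apply: le_trans (ler_pM _ _ (bK k.+1) I1) _ => //.
  by rewrite mulrACA [X in _ <= _ * X]mulrC.
Qed.

End Modulation.

(** * Convolution of a measure with a kernel *)

Section Smoothing.
Context {R : realType}.
Local Notation mu := (@lebesgue_measure R).
Local Notation I01 := (`[0%R, 1%R]%classic : set R).
Variables (sigma : {finite_measure set (circle R) -> \bar R}).
Variables (p : nat) (h : R) (a : nat -> R) (Phi : R -> R).
Hypotheses (p2 : (2 <= p)%N) (kP : smooth_kernel p h a Phi).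

(** A chosen argument, with no claim of measurability. [Phi (t - circle_arg y)] is still measurable
    in [y], since its series involves [y] only through [circle_cos m y] and [circle_sin m y]. *)
Definition circle_arg (y : circle R) : R := s2val (cid2 (turn_surj y)).

Lemma turn_arg y : turn (circle_arg y) = y.
Proof. by rewrite /circle_arg; case: cid2. Qed.

(* Density of the convolution of sigma with the kernel Phi. *)
Definition smoothed t : R := \int[sigma]_y Phi (t - circle_arg y).

Let cos_shift_arg m t y : cos (2 * pi * m%:R * (t - circle_arg y)) =
  cos (2 * pi * m%:R * t) * circle_cos m y + sin (2 * pi * m%:R * t) * circle_sin m y.
Proof. by rewrite -{2 3}(turn_arg y) circle_cos_turn circle_sin_turn mulrBr cosB. Qed.

Let bu m t : bounded_measurable setT (fun y => cos (2 * pi * m%:R * (t - circle_arg y))).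
Proof.
rewrite (funext (cos_shift_arg m t)).
by apply: bounded_measurableD; apply: bounded_measurableM;
  try exact: bounded_measurable_cst; [exact: bm_circle_cos|exact: bm_circle_sin].
Qed.

Let harmonic m t : R :=
  cos (2 * pi * m%:R * t) * cos_coef sigma m + sin (2 * pi * m%:R * t) * sin_coef sigma m.

Lemma smoothed_series t :
  (fun n => \sum_(0 <= m < n) a m * harmonic m t) @ \oo --> smoothed t.
Proof.
have [S aS] := kernel_summable p2 kP.
have H := cvg_Rintegral_series measurableT (fin_measureT sigma) aS
  (fun m => (bu m t).1) (fun m y _ => cos_max _)
  (fun y _ => @kernel_series _ _ _ _ _ kP (t - circle_arg y))
  (bounded_measurable_cst setT 1).
rewrite (_ : smoothed t = \int[sigma]_y (Phi (t - circle_arg y) * 1)); last first.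
  by apply: eq_Rintegral => y _; rewrite mulr1.
apply: cvg_trans H; apply: near_eq_cvg; apply: nearW => n; apply: eq_bigr => m _.
congr (_ * _); under eq_Rintegral do rewrite mulr1 cos_shift_arg.
have bc := bm_circle_cos m; have bs := bm_circle_sin m.
rewrite (bm_RintegralD measurableT (fin_measureT sigma)).
- by rewrite !(bm_RintegralZl measurableT (fin_measureT sigma)).
- by apply: bounded_measurableM => //; exact: bounded_measurable_cst.
- by apply: bounded_measurableM => //; exact: bounded_measurable_cst.
Qed.

(** Termwise integration asks for functions bounded by 1, so the harmonics are divided by [M] and
    the coefficients multiplied by it. The 1 keeps [M] positive for the zero measure. *)
Let M : R := 2 * fine (sigma setT) + 1.

Let M0 : 0 < M.
Proof. by rewrite ltr_wpDl// mulr_ge0// fine_ge0. Qed.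

Let bharmonic m : bounded_measurable I01 (harmonic m).
Proof. by rewrite /harmonic; solve_bm. Qed.

Let harmonic_le m t : `|harmonic m t / M| <= 1.
Proof.
rewrite normrM normfV (ger0_norm (ltW M0)) ler_pdivrMr// mul1r.
have h1 := norm_cos_coef_le sigma m; have h2 := norm_sin_coef_le sigma m.
apply: le_trans (ler_normD _ _) _; rewrite !normrM /M.
have := ler_piMl (normr_ge0 (cos_coef sigma m)) (cos_max (2 * pi * m%:R * t)).
have := ler_piMl (normr_ge0 (sin_coef sigma m)) (sin_max (2 * pi * m%:R * t)).
lra.
Qed.

Let scaled_summable : exists S, forall n, \sum_(0 <= m < n) `|a m * M| <= S.
Proof.
have [S aS] := kernel_summable p2 kP; exists (S * M) => n.
under eq_bigr do rewrite normrM (ger0_norm (ltW M0)).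
by rewrite -mulr_suml ler_wpM2r// ltW.
Qed.

Let scaled_series t :
  (fun n => \sum_(0 <= m < n) a m * M * (harmonic m t / M)) @ \oo --> smoothed t.
Proof.
rewrite (_ : (fun n => _) = (fun n => \sum_(0 <= m < n) a m * harmonic m t)).
  exact: smoothed_series.
apply/funext => n; apply: eq_bigr => m _.
by field; rewrite gt_eqF.
Qed.

Let bscaled m : bounded_measurable I01 (fun t => harmonic m t / M).
Proof. by apply: bounded_measurableM => //; exact: bounded_measurable_cst. Qed.

Lemma bm_smoothed : bounded_measurable I01 smoothed.
Proof.
have [S aS] := scaled_summable.
by apply: (bounded_measurable_series aS (fun m => (bscaled m).1)) => [m t _|t _];
  [exact: harmonic_le|exact: scaled_series].
Qed.

Let cvg_smoothed (v : R -> R) : bounded_measurable I01 v ->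
  (fun n => \sum_(0 <= m < n) a m * \int[mu]_(t in I01) (harmonic m t * v t)) @ \oo -->
  \int[mu]_(t in I01) (smoothed t * v t).
Proof.
move=> bv; have [S aS] := scaled_summable.
have H := cvg_Rintegral_series measurable01 lebesgue01_fin aS (fun m => (bscaled m).1)
  (fun m t _ => harmonic_le m t) (fun t _ => @scaled_series t) bv.
apply: cvg_trans H; apply: near_eq_cvg; apply: nearW => n; apply: eq_bigr => m _.
rewrite -mulrA; congr (_ * _).
rewrite -Rintegral01Zl; last exact: bounded_measurableM.
by apply: eq_Rintegral => t _; field; rewrite gt_eqF.
Qed.

Lemma smoothed_cos_coef n :
  \int[mu]_(t in I01) (smoothed t * cos (2 * pi * n%:R * t)) =
  a n / kappa n * cos_coef sigma n.
Proof.
have bc : bounded_measurable I01 (fun t : R => cos (2 * pi * n%:R * t)).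
  exact: bounded_measurable_cos_mul.
have /cvg_lim <-// := cvg_smoothed bc; apply/cvg_lim => //.
pose c m := a m * \int[mu]_(t in I01) (harmonic m t * cos (2 * pi * n%:R * t)).
have cE m : c m = a m * (cos_coef sigma m * (if m == n then (kappa n)^-1 else 0)).
  rewrite /c; congr (_ * _); rewrite -Rintegral01_coscos.
  have E (t : R) : harmonic m t * cos (2 * pi * n%:R * t) =
      cos_coef sigma m * (cos (2 * pi * m%:R * t) * cos (2 * pi * n%:R * t)) +
      sin_coef sigma m * (cos (2 * pi * n%:R * t) * sin (2 * pi * m%:R * t)).
    by rewrite /harmonic; ring.
  under eq_Rintegral do rewrite E.
  rewrite Rintegral01D; [|by solve_bm..].
  rewrite !Rintegral01Zl; [|by solve_bm..].
  by rewrite Rintegral01_cossin mulr0 addr0.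
have -> : a n / kappa n * cos_coef sigma n = c n by rewrite cE eqxx; ring.
by apply: (cvg_sum_single (c := c)) => m /negbTE mn; rewrite cE mn !mulr0.
Qed.

Lemma smoothed_sin_coef n :
  \int[mu]_(t in I01) (smoothed t * sin (2 * pi * n%:R * t)) =
  a n / kappa n * sin_coef sigma n.
Proof.
have bc : bounded_measurable I01 (fun t : R => sin (2 * pi * n%:R * t)).
  exact: bounded_measurable_sin_mul.
have /cvg_lim <-// := cvg_smoothed bc; apply/cvg_lim => //.
pose c m := a m * \int[mu]_(t in I01) (harmonic m t * sin (2 * pi * n%:R * t)).
have cE m : c m = a m * (sin_coef sigma m * (if (m == n) && (0 < n)%N then 2^-1 else 0)).
  rewrite /c; congr (_ * _); rewrite -Rintegral01_sinsin.
  have E (t : R) : harmonic m t * sin (2 * pi * n%:R * t) =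
      cos_coef sigma m * (cos (2 * pi * m%:R * t) * sin (2 * pi * n%:R * t)) +
      sin_coef sigma m * (sin (2 * pi * m%:R * t) * sin (2 * pi * n%:R * t)).
    by rewrite /harmonic; ring.
  under eq_Rintegral do rewrite E.
  rewrite Rintegral01D; [|by solve_bm..].
  rewrite !Rintegral01Zl; [|by solve_bm..].
  by rewrite Rintegral01_cossin mulr0 add0r.
(* At [n = 0] the sine has norm 0, which does not match [kappa 0], but the sine coefficient of
   [sigma] vanishes as well. *)
have -> : a n / kappa n * sin_coef sigma n = c n.
  rewrite cE eqxx /kappa; have [n0|n0] := posnP n; last by rewrite /=; ring.
  rewrite n0 /sin_coef /circle_sin; under eq_Rintegral do rewrite expr0.
  by rewrite Rintegral_cst//= mul0r !mulr0.
by apply: (cvg_sum_single (c := c)) => m /negbTE mn; rewrite cE mn !mulr0.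
Qed.

Lemma smoothed_ge0 t : 0 <= smoothed t.
Proof. by apply: Rintegral_ge0 => y _; exact: kernel_ge0 kP _. Qed.

(** The closed ball of radius [2 h] about [turn t] misses the support, hence is null, and outside it
    the kernel vanishes. The 2 converts [|sin|] into a chord. *)
Lemma smoothed_support t :
  (forall y, measure_support sigma y -> 2 * h < mdist (turn t) y) -> smoothed t = 0.
Proof.
move=> far; pose K := [set y : circle R | mdist (turn t) y <= 2 * h].
have cK : closed K.
  apply: (@preimage_closed _ _ (mdist (turn t)) [set u | u <= 2 * h]) => [y _|].
    apply: (@lipschitz_continuous_circle _ _ 1) => z y'; rewrite mul1r ler_norml.
    have := metric_triangle (turn t) z y'; have := metric_triangle (turn t) y' z.
    by rewrite (metric_sym y' z); lra.
  exact: closed_le.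
have mK : measurable K by exact: measurable_closed_circle.
have K0 : sigma K = 0%E.
  apply: compl_support_null => //; apply/seteqP; split => y // [Ky /far].
  by rewrite ltNge => /negP.
have [S aS] := kernel_summable p2 kP.
have bG : bounded_measurable setT (fun y => Phi (t - circle_arg y)).
  apply: (bounded_measurable_series aS (fun m => (bu m t).1)) => [m y _|y _].
    exact: cos_max.
  exact: (kernel_series kP).
have GS y : `|Phi (t - circle_arg y)| <= S.
  apply: (@normr_series_le _ _ _ setT a (fun m y => cos (2 * pi * m%:R * (t - circle_arg y)))
    (fun y => Phi (t - circle_arg y)) S aS) => // [m z _|z _]; first exact: cos_max.
  exact: (kernel_series kP).
apply/normr0_eq0/eqP; rewrite eq_le normr_ge0 andbT.
apply: le_trans (bm_normr_Rintegral measurableT (fin_measureT sigma) bG) _.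
have bK : bounded_measurable setT (\1_K : circle R -> R).
  split; first exact: measurable_indic.
  by exists 1 => y _; rewrite indicE; case: (_ \in _); rewrite ?normr1 ?normr0.
apply: (@le_trans _ _ (\int[sigma]_y (S * \1_K y))).
  apply: (bm_le_Rintegral measurableT (fin_measureT sigma)) => [||y _].
  - exact: bounded_measurable_norm.
  - by apply: bounded_measurableM => //; exact: bounded_measurable_cst.
  rewrite indicE; have [yK|yK] := boolP (y \in K); first by rewrite mulr1.
  rewrite mulr0 (kernel_support kP) ?normr0//.
  move: yK; rewrite notin_setE /K/= => /negP;
    rewrite -ltNge -{1}(turn_arg y) mdist_turn.
  by rewrite ltr_pM2l// => /ltW.
rewrite (bm_RintegralZl measurableT (fin_measureT sigma))//.
rewrite /Rintegral integral_indic// setIT.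
by rewrite [X in fine X](_ : _ = 0%E) ?mulr0//; exact: K0.
Qed.

End Smoothing.

(** * Approximation by measures on sparse sets *)

Section SparseSet.
Context {R : realType}.
Local Notation I01 := (`[0%R, 1%R]%classic : set R).

(* N arcs centred at the N-th roots of unity: Re (z ^ N) >= 1 - 2 h^2 means that
   |sin (N arg z / 2)| <= h. *)
Definition comb N (h : R) : set (circle R) := [set z | 1 - 2 * h ^+ 2 <=
  circle_cos N z].

Lemma comb_turn N (h t : R) : 0 <= h ->
  comb N h (turn t) <-> `|sin (pi * (N%:R * t))| <= h.
Proof.
move=> h0; rewrite /comb/= circle_cos_turn.
rewrite (_ : 2 * pi * N%:R * t = 2 * (pi * (N%:R * t))); last by ring.
have := cos_double (pi * (N%:R * t)).
rewrite -[sin _ ^+ 2]real_normK ?num_real//.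
set s := `|sin _|; have s0 : 0 <= s by exact: normr_ge0.
move=> E; split => [h1|sh].
  by rewrite -(ler_pXn2r (ltn0Sn 1))// ?nnegrE//; lra.
have : s ^+ 2 <= h ^+ 2 by rewrite lerXn2r ?nnegrE.
lra.
Qed.

Lemma closed_comb N (h : R) : closed (comb N h).
Proof. exact: closed_circle_cos_ge. Qed.

(** The N-th power map multiplies chords by at most [N], so moving by [2 h / N] changes
    [|sin (pi N t)|] by at most [h]. *)
Lemma comb_enlarge N (h : R) (z y : circle R) : (0 < N)%N -> 0 <= h ->
  comb N h y -> mdist z y <= 2 * h / N%:R -> comb N (2 * h) z.
Proof.
move=> N0 h0; have [t _ ->] := turn_surj z; have [s _ ->] := turn_surj y.
have N0' : 0 < N%:R :> R by rewrite ltr0n.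
move=> /(comb_turn _ _ h0) hs; rewrite mdist_turn ler_pdivlMr// => ts.
apply/comb_turn; first by rewrite mulr_ge0.
have -> : pi * (N%:R * t) = N%:R * (pi * (t - s)) + pi * (N%:R * s) by ring.
apply: le_trans (norm_sinD_le _ _) _.
have := sin_natM_le N (pi * (t - s)); nra.
Qed.

Lemma sin_pi_dist_nat (x : R) : 0 <= x ->
  exists2 j : nat, j%:R <= x + 1 / 2 & `|x - j%:R| <= `|sin (pi * x)|.
Proof.
move=> x0; have x2 : 0 <= x + 1 / 2 by lra.
have /andP[jx xj] := truncn_itv x2; set j := Num.truncn _ in jx xj.
exists j => //; have -> : `|sin (pi * x)| = `|sin (pi * (x - j%:R))|.
  by rewrite -(norm_sinDpin (pi * (x - j%:R)) j); congr `|sin _|; ring.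
have : `|x - j%:R| <= 1 / 2 by rewrite ler_norml; move: xj;
  rewrite -[j.+1%:R]natr1; lra.
set s := x - j%:R => s2.
have -> : `|sin (pi * s)| = `|sin (pi * `|s|)|.
  have [k|k] := leP 0 s; first by rewrite (ger0_norm k).
  by rewrite (ltr0_norm k) mulrN sinN normrN.
by apply: le_trans (ler_norm _); apply: sin_pi_ge; rewrite normr_ge0.
Qed.

(** In the parameter [t] there are [N + 1] intervals of length [2 h / N], the arc around 1 being cut
    at the ends of [0, 1[; and [(N + 1) / N <= 2]. *)
Lemma arc_length_comb N (h : R) (A : set (circle R)) : (0 < N)%N -> 0 <= h ->
  measurable A -> A `<=` comb N h -> (arc_length A <= (4 * h)%:E)%E.
Proof.
move=> N0 h0 mA AN; have N0' : 0 < N%:R :> R by rewrite ltr0n.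
pose J j : set R := `[(j%:R - h) / N%:R, (j%:R + h) / N%:R]%classic.
have sub : `[0, 1[ `&` [set t | A (turn t)] `<=` \bigcup_(j in `I_N.+1) J j.
  move=> t [/=]; rewrite in_itv/= => /andP[t0 t1] /AN /(comb_turn _ _ h0) th.
  have Nt : 0 <= N%:R * t by rewrite mulr_ge0.
  have [j jN jt] := sin_pi_dist_nat Nt; exists j => /=.
    rewrite -(ltr_nat R) -[N.+1%:R]natr1; nra.
  have := le_trans jt th; rewrite ler_norml => /andP[h1 h2].
  by rewrite /J/= in_itv/= ler_pdivrMr// ler_pdivlMr//; lra.
have mAt : measurable (`[0, 1[ `&` [set t | A (turn t)] : set (measurableTypeR R)).
  apply: measurableI; first exact: measurable_itv.
  by rewrite -[X in measurable X]setTI; exact: measurable_turn.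
have := content_sub_fsum (@lebesgue_measure R) (finite_II N.+1)
  (fun j _ => measurable_itv _ : measurable (J j : set (measurableTypeR R))) mAt sub.
move=> /le_trans; apply.
rewrite -fsbig_ord/=.
apply: (@le_trans _ _ (\sum_(j < N.+1) (2 * h / N%:R)%:E)%E).
  apply: lee_sum => j _; rewrite /J lebesgue_measure_itv/= lte_fin.
  case: ifP => _; last by rewrite lee_fin divr_ge0// mulr_ge0.
  by rewrite -EFinB lee_fin -mulrBl ler_wpM2r ?invr_ge0//; lra.
rewrite sumEFin lee_fin sumr_const card_ord -[_ *+ N.+1]mulr_natl.
rewrite mulrA ler_pdivrMr//.
have : 1 <= N%:R :> R by rewrite ler1n.
rewrite -[N.+1%:R]natr1; nra.
Qed.

Lemma closed_measure_support (mu : {measure set (circle R) -> \bar R}) :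
  closed (measure_support mu).
Proof.
rewrite -[measure_support mu]setCK; apply: open_closedC; rewrite openE => z /=.
move=> /existsNP[U /not_implyP[oU /not_implyP[Uz U0]]].
rewrite /interior; apply: (@filterS _ (nbhs z) _ U); last exact: open_nbhs_nbhs.
by move=> y Uy sy; apply: U0; exact: sy.
Qed.

End SparseSet.

Lemma hdist_lt {R : realType} (E F : set (circle R)) (r : R) (z : circle R) :
  E !=set0 -> F z -> hdist E F < r -> exists2 y, E y & mdist z y < r.
Proof.
move=> E0 Fz hr; apply: contrapT => far; move: hr; apply/negP; rewrite -leNgt.
have [x Ex] := E0.
have F0 : F !=set0 by exists z.
have ub (G H : set (circle R)) : H !=set0 -> has_ubound [set dist_to y H | y in G].
  move=> [y Hy]; exists 2 => _ [y' _ <-].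
  exact: le_trans (dist_to_le _ Hy) (mdist_circle_le2 _ _).
have zE : r <= dist_to z E.
  apply: lb_le_inf; first by exists (mdist z x), x.
  move=> _ [y Ey <-]; rewrite leNgt; apply/negP => zy; apply: far.
  by exists y.
have h1 : dist_to z E <= sup [set dist_to y E | y in F].
  by apply: ub_le_sup; [exact: ub|exists z].
have h2 : dist_to x F <= sup [set dist_to y F | y in E].
  by apply: ub_le_sup; [exact: ub|exists x].
have h3 := dist_to_ge0 x F0.
rewrite /hdist; lra.
Qed.

(** * The approximating pair *)

Section Approximation.
Context {R : realType}.
Variable w : nat -> {posnum R}.
Local Notation mu := (@lebesgue_measure R).
Local Notation I01 := (`[0%R, 1%R]%classic : set R).

Lemma turn_near_root (N : nat) (t : R) : (0 < N)%N -> I01 t ->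
  exists j : nat, mdist (turn t) (turn (j%:R / N%:R)) <= 2 * pi / N%:R.
Proof.
move=> N0; rewrite /= in_itv/= => /andP[t0 t1].
have N0' : 0 < N%:R :> R by rewrite ltr0n.
have Nt : 0 <= N%:R * t by rewrite mulr_ge0.
have /andP[jx xj] := truncn_itv Nt; exists (Num.truncn (N%:R * t)).
apply: le_trans (mdist_turn_le _ _) _; rewrite ler_wpM2l ?mulr_ge0 ?pi_ge0//.
have E : t = N%:R * t / N%:R by field; rewrite gt_eqF.
rewrite {1}E -mulrBl normrM normfV (ger0_norm (ltW N0')) ler_piMl ?invr_ge0//.
by move: xj; rewrite -natr1 ler_norml; lra.
Qed.

Lemma approximation (A : nat) (p : measure_pair w) (e h : R) :
  sparse_small w A -> 0 < e -> 0 < h ->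
  exists2 q : measure_pair w, pair_dist p q < e &
    exists2 N, (0 < N)%N & pair_set q `<=` comb N h.
Proof.
move=> wA e0 h0.
pose sigma := pair_measure p; pose E := pair_set p.
have E0 : E !=set0 := pair_set_nonempty p.
have [S vS] := ell2_term_summable (pair_measure_ell2 p).
have e320 : 0 < e ^+ 2 / 32 by rewrite divr_gt0 ?exprn_gt0.
have [k0 k00 mult] := multiplier_sum_le (ell2_term_ge0 w sigma) vS e320.
(* Error budget: Hausdorff distance at most [2 * r = e / 4], norm at most [e / 2]. *)
pose r := e / 8; have r0 : 0 < r by rewrite divr_gt0.
pose k := Num.min k0 (r / 4).
have kp : 0 < k by rewrite lt_min k00 divr_gt0.
have kk0 : k <= k0 by rewrite ge_min lexx.
(* Smoothing at width [k] moves the support by at most [2 k] in chordal distance, hence within the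
   [r]-neighbourhood of [E]. *)
have kr : 2 * k < r by have : k <= r / 4 by [rewrite ge_min lexx orbT|]; lra.
have [pa [a [Phi [pa2 Apa kP]]]] := smooth_kernel_exists (A + 2) kp.
have [pb [b [Psi [pb2 Apb kQ]]]] := smooth_kernel_exists (A + 2) h0.
have [Ka Ka0 aK] := kernel_decay_le Apa kP.
have [Kb Kb0 bK] := kernel_decay_le Apb kQ.
pose K1 := Ka * fine (sigma setT).
have K10 : 0 <= K1 by rewrite mulr_ge0// fine_ge0.
pose K := Kb * K1; have K0 : 0 <= K by rewrite mulr_ge0.
(* [K] depends on [sigma] and the two kernels only, so [d], and then [N], may be chosen after it. *)
pose d := e / (64 * (K + 1)).
have d0 : 0 < d by rewrite divr_gt0// mulr_gt0// ltr_wpDl.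
have dK : (d * K) ^+ 2 <= e ^+ 2 / 4096.
  have h1 : d * K <= e / 64.
    have K10' : 0 < K + 1 by rewrite ltr_wpDl.
    have -> : d * K = e / 64 * (K / (K + 1)) by rewrite /d; field; rewrite gt_eqF.
    by rewrite ler_piMr ?divr_ge0 ?(ltW e0)// ler_pdivrMr// mul1r lerDl.
  have -> : e ^+ 2 / 4096 = (e / 64) ^+ 2 by field.
  have dK0 : 0 <= d * K by rewrite mulr_ge0// ltW.
  have e64 : 0 <= e / 64 by rewrite divr_ge0// ltW.
  by rewrite lerXn2r ?nnegrE.
(* [N > 2 pi / r] makes the N-th roots of unity [r]-dense. *)
have [N rN wN] := wA d (Num.truncn (2 * pi / r)) d0.
have N0 : (0 < N)%N by exact: leq_ltn_trans rN.
have N0' : 0 < N%:R :> R by rewrite ltr0n.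
have piN : 2 * pi / N%:R <= r.
  have t0 : 0 <= 2 * pi / r by rewrite divr_ge0 ?(ltW r0)// mulr_ge0// pi_ge0.
  have /andP[_ h1] := truncn_itv t0.
  have h2 : 2 * pi / r <= N%:R by apply: le_trans (ltW h1) _; rewrite ler_nat.
  by move: h2; rewrite !ler_pdivrMr// [r * _]mulrC.
pose f := smoothed sigma Phi.
have bf : bounded_measurable I01 f := bm_smoothed sigma pa2 kP.
pose g t := f t * Psi (N%:R * t).
have bg : bounded_measurable I01 g.
  by apply: bounded_measurableM => //; exact: bm_kernel_scale kQ.
have g0 t : I01 t -> 0 <= g t.
  by move=> _; rewrite mulr_ge0 ?(smoothed_ge0 _ kP) ?(kernel_ge0 kQ).
pose tau := push_density_measure measurable01 lebesgue01_fin measurable_turn bg g0.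
(* The support of [tau] alone would not do: [F] must stay Hausdorff close to [E] even where [sigma]
   has no mass. The roots of unity near [E] ensure this. *)
pose F := [set z | dist_to z E <= r] `&` comb N h.
have cF : closed F by apply: closedI; [exact: closed_dist_to|exact: closed_comb].
have near x : E x -> exists2 y, F y & mdist x y <= r.
  have [t It ->] := turn_surj x => Ex.
  have [j jt] := turn_near_root N0 It.
  have {}jt := le_trans jt piN.
  exists (turn (j%:R / N%:R)) => //; split => /=.
    by apply: le_trans (dist_to_le _ Ex) _; rewrite metric_sym.
  apply/(comb_turn _ _ (ltW h0)).
  rewrite (_ : pi * (N%:R * (j%:R / N%:R)) = 0 + pi * j%:R); last first.
    by field; rewrite gt_eqF.
  by rewrite norm_sinDpin sin0 normr0 ltW.
have F0 : F !=set0 by case: E0 => x /near[y Fy _]; exists y.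
have gF t : ~ F (turn t) -> g t = 0.
  move=> nF; rewrite /g; have [tE|Et] := leP (dist_to (turn t) E) r; last first.
    rewrite /f (smoothed_support pa2 kP) ?mul0r// => y sy.
    apply: lt_le_trans kr _; apply: le_trans (ltW Et) _.
    exact/dist_to_le/(pair_support sy).
  rewrite (kernel_support kQ) ?mulr0// leNgt; apply/negP => hs; apply: nF; split => //.
  exact/(comb_turn _ _ (ltW h0))/ltW.
have tauF : measure_support tau `<=` F.
  move=> z sz; apply: contrapT => nF.
  have oF : open (~` F) := closed_openC cF.
  have tauC : tau (~` F) = 0%E.
    by apply: push_density_null => [|t _]; [exact: measurable_open_circle|exact: gF].
  have := sz _ oF nF; rewrite lt_neqAle => /andP[/eqP nul _].
  by apply: nul; exact: esym tauC.
have tau_cos n : cos_coef tau n =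
    \int[mu]_(t in I01) (f t * Psi (N%:R * t) * cos (2 * pi * n%:R * t)).
  rewrite /cos_coef Rintegral_push_density; last exact: bm_circle_cos.
  by apply: eq_Rintegral => t _; rewrite circle_cos_turn mulrC.
have tau_sin n : sin_coef tau n =
    \int[mu]_(t in I01) (f t * Psi (N%:R * t) * sin (2 * pi * n%:R * t)).
  rewrite /sin_coef Rintegral_push_density; last exact: bm_circle_sin.
  by apply: eq_Rintegral => t _; rewrite circle_sin_turn mulrC.
pose c n := a n / kappa n.
have coef_le n (x : R) : `|x| <= fine (sigma setT) ->
    `|c n * x| <= K1 / n.+1%:R ^+ (A + 2).
  move=> xs; rewrite normrM /K1 mulrAC; apply: ler_pM => //.
  apply: le_trans (aK n); rewrite /c normrM ler_piMr// normfV (ger0_norm (ltW (kappa_gt0 n))).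
  by rewrite invf_le1 ?kappa_gt0// kappa_ge1.
have modcos := modulation_coef_le (ltW d0) K10 Kb0 pb2 kQ wN bK bf
  (fun n => bounded_measurable_cos_mul I01 (2 * pi * n%:R)).
have modsin := modulation_coef_le (ltW d0) K10 Kb0 pb2 kQ wN bK bf
  (fun n => bounded_measurable_sin_mul I01 (2 * pi * n%:R)).
have shift n M (t : R) : (M <= n)%N ->
    2 * pi * (n - M + (M - n))%N%:R * t = 2 * pi * n%:R * t - 2 * pi * M%:R * t.
  by move=> Mn; rewrite (eqP Mn) addn0 natrB//; ring.
have shift' n M (t : R) : (n <= M)%N ->
    2 * pi * (n - M + (M - n))%N%:R * t = - (2 * pi * n%:R * t - 2 * pi * M%:R * t).
  by move=> nM; rewrite (eqP nM) add0n natrB//; ring.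
have shiftD n M (t : R) :
    2 * pi * (n + M)%N%:R * t = 2 * pi * n%:R * t + 2 * pi * M%:R * t.
  by rewrite natrD; ring.
have {}modcos : forall L, \sum_(0 <= n < L)
    (cos_coef tau n - c n * cos_coef sigma n) ^+ 2 * (w n)%:num <= 16 * (d * K) ^+ 2.
  move=> L; have := modcos _ _ L;
    under eq_bigr do rewrite -tau_cos (smoothed_cos_coef sigma pa2 kP).
  apply.
  - move=> n M; exists 1; first by rewrite normr1.
    move=> t; rewrite mul1r shiftD mulrC cosM_sum addrC.
    have [Mn|/ltnW nM] := leqP M n; first by rewrite shift.
    by rewrite shift'// cosN.
  - move=> n; rewrite (smoothed_cos_coef sigma pa2 kP).
    exact/coef_le/norm_cos_coef_le.
have {}modsin : forall L, \sum_(0 <= n < L)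
    (sin_coef tau n - c n * sin_coef sigma n) ^+ 2 * (w n)%:num <= 16 * (d * K) ^+ 2.
  move=> L; have := modsin _ _ L;
    under eq_bigr do rewrite -tau_sin (smoothed_sin_coef sigma pa2 kP).
  apply.
  - move=> n M; have [Mn|/ltnW nM] := leqP M n.
      exists 1 => [|t]; first by rewrite normr1.
      by rewrite mul1r shiftD shift// mulrC sincosM_sum.
    (* For [n < M] the difference frequency is negative, and the sine is odd. *)
    exists (-1) => [|t]; first by rewrite normrN normr1.
    by rewrite shiftD shift'// sinN mulrNN mul1r mulrC sincosM_sum.
  - move=> n; rewrite (smoothed_sin_coef sigma pa2 kP).
    exact/coef_le/norm_sin_coef_le.
have {}mult : forall L, \sum_(0 <= n < L) (1 - c n) ^+ 2 * ell2_term w sigma n <=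
  e ^+ 2 / 32.
  apply: (mult k); first by rewrite kp.
    by move=> n; exact: kernel_coef_dist1 kP n.
  by move=> n; exact: kernel_coef_le1 kP n.
have close : (ell2_sqnorm w (fun n => fourier sigma n - fourier tau n)%R <=
    ((e / 2) ^+ 2)%:E)%E.
  have -> : (e / 2) ^+ 2 = 2 * (e ^+ 2 / 8) by field.
  apply: (@ell2_sqnorm_le _ w _ (fun n => (cos_coef sigma n - cos_coef tau n) ^+ 2 +
      (sin_coef sigma n - sin_coef tau n) ^+ 2)) => [n|L].
    by rewrite normc_fourierB.
  (* Smoothing error plus modulation error, separated by [(s - t) ^ 2 <= 2 s ^ 2 + 2 t ^ 2]. The
     total is at most [2 e ^ 2 / 32 + 64 e ^ 2 / 4096], which is below [e ^ 2 / 8]. *)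
  apply: (@le_trans _ _ (2 * \sum_(0 <= n < L) (1 - c n) ^+ 2 * ell2_term w sigma n +
      (2 * \sum_(0 <= n < L) (cos_coef tau n - c n * cos_coef sigma n) ^+ 2 * (w n)%:num +
       2 * \sum_(0 <= n < L) (sin_coef tau n - c n * sin_coef sigma n) ^+ 2 * (w n)%:num))).
    rewrite !mulr_sumr -!big_split/=; apply: ler_sum => n _.
    rewrite /ell2_term; set x := cos_coef sigma n; set y := sin_coef sigma n.
    set x' := cos_coef tau n; set y' := sin_coef tau n; set u := c n.
    have -> : 2 * ((1 - u) ^+ 2 * ((x ^+ 2 + y ^+ 2) * (w n)%:num)) +
      (2 * ((x' - u * x) ^+ 2 * (w n)%:num) + 2 * ((y' - u * y) ^+ 2 * (w n)%:num)) =
      (2 * ((1 - u) * x) ^+ 2 + 2 * (x' - u * x) ^+ 2 +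
       (2 * ((1 - u) * y) ^+ 2 + 2 * (y' - u * y) ^+ 2)) * (w n)%:num by ring.
    rewrite ler_wpM2r//.
    have two (s t : R) : (s - t) ^+ 2 <= 2 * s ^+ 2 + 2 * t ^+ 2.
      rewrite -subr_ge0 (_ : _ - _ = (s + t) ^+ 2) ?sqr_ge0//; ring.
    apply: lerD.
      have -> : x - x' = (1 - u) * x - (x' - u * x) by ring.
      exact: two.
    have -> : y - y' = (1 - u) * y - (y' - u * y) by ring.
    exact: two.
  have := mult L; have := modcos L; have := modsin L; lra.
have ell2_tau : ell2 w (fourier tau).
  have -> : fourier tau = (fun n => fourier sigma n +
      (- (fourier sigma n - fourier tau n)))%R.
    by apply/funext => n; rewrite opprB addrC subrK.
  apply: ell2D; first exact: pair_measure_ell2.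
  apply: ell2N; apply: le_lt_trans close _; exact: ltey.
pose q := MeasurePair (push_density_not_measurable _ _ _ _ : forall B,
  ~ measurable B -> tau B = 0%E)
  ell2_tau F0 (closed_compact_circle cF) tauF.
exists q; last by exists N => // z [].
rewrite /pair_dist /q/=.
have hd : hdist E F <= r + r.
  rewrite /hdist; apply: lerD.
    case: E0 => x0 Ex0; apply: ge_sup; first by exists (dist_to x0 F), x0.
    move=> _ [x /near[y Fy xy] <-]; exact: le_trans (dist_to_le _ Fy) xy.
  have [y0 Fy0] := F0; apply: ge_sup; first by exists (dist_to y0 E), y0.
  by move=> _ [y [Fy _] <-].
have nd : ell2_norm w (fun n => fourier sigma n - fourier tau n) <= e / 2.
  rewrite /ell2_norm -[leRHS]ger0_norm ?divr_ge0 ?(ltW e0)// -sqrtr_sqr.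
  apply: ler_wsqrtr; rewrite -lee_fin fineK// ge0_fin_numE ?ell2_sqnorm_ge0//.
  by apply: le_lt_trans close _; exact: ltey.
by apply: le_lt_trans (lerD hd nd) _; rewrite /r; lra.
Qed.

End Approximation.

(** * Genericity *)

Theorem theorem2p1 (R : realType) (w : nat -> {posnum R})
  (w_liminf : limn_einf (fun n => ((w n)%:num)%:E) = 0%E)
  (w_regular : nonincreasing_seq (fun n => (w n)%:num) \/
     exists C : R, 1 < C /\
       forall n : nat, (1 <= n)%N -> forall k : nat, (n <= k <= 2 * n)%N ->
         C^-1 * (w n)%:num <= (w k)%:num <= C * (w n)%:num) :
  generic [set p : measure_pair w |
    arc_length (measure_support (pair_measure p)) = 0%E].
Proof.
have [A wA] : exists A, sparse_small w A.
  case: w_regular => [dw|[C [C1 wC]]]; last exact: sparse_small_doubling C1 wC.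
  by exists 1%N; exact: sparse_small_nonincreasing.
pose B k := [set p : measure_pair w |
  ((k.+1%:R^-1)%:E <= arc_length (measure_support (pair_measure p)))%E].
exists B; last first.
  apply/seteqP; split => [p /= p0|p [k _] /= Bp p0].
    have : (0 <= arc_length (measure_support (pair_measure p)))%E by exact: measure_ge0.
    rewrite le_eqVlt => /predU1P[/esym//|].
    case E : (arc_length _) => [x| |//]; last first.
      by move=> _; exists 0%N => //; rewrite /B/= E leey.
    rewrite lte_fin => x0; exists (Num.truncn x^-1) => //.
    rewrite /B/= E lee_fin invf_ple ?posrE//.
    have x0' : 0 <= x^-1 by rewrite invr_ge0 ltW.
    by have /andP[_ /ltW] := truncn_itv x0'.
  by move: Bp; rewrite /B/= p0 lee_fin leNgt invr_gt0 ltr0n.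
move=> k; rewrite /nowhere_dense -subset0 => p.
rewrite /interior/= => /nbhs_ballP[e /= e0 pe].
(* A set inside [comb N (2 * h)] then has length at most [8 h = 1 / (2 (k + 1))], too little to
   belong to [B k]. *)
pose h : R := (16 * k.+1%:R)^-1.
have h0 : 0 < h by rewrite invr_gt0 mulr_gt0.
have [q pq [N N0 qN]] := approximation p wA e0 h0.
have N0' : 0 < N%:R :> R by rewrite ltr0n.
pose r := 2 * h / N%:R; have r0 : 0 < r by rewrite divr_gt0// mulr_gt0.
(* The pair [q] lies in the closure of [B k], so a ball around it meets [B k] however small its
   radius, which may therefore depend on [N]. *)
have [q' [Bq' qq']] := pe q pq (ball q r) (nbhsx_ballx q _ r0).
have {}qq' : pair_dist q q' < r by [].
have q'N : pair_set q' `<=` comb N (2 * h).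
  move=> z q'z; have hd : hdist (pair_set q) (pair_set q') < r.
    apply: le_lt_trans qq'; rewrite /pair_dist lerDl; exact: sqrtr_ge0.
  have [y qy zy] := hdist_lt (pair_set_nonempty q) q'z hd.
  exact: comb_enlarge N0 (ltW h0) (qN _ qy) (ltW zy).
have h2 : 0 <= 2 * h by rewrite mulr_ge0// ltW.
have ms : measurable (measure_support (pair_measure q')).
  by apply: measurable_closed_circle; exact: closed_measure_support.
have := arc_length_comb N0 h2 ms (subset_trans (@pair_support _ _ q') q'N).
move=> /(le_trans Bq'); rewrite lee_fin leNgt => /negP; apply.
rewrite /h -[ltRHS]mul1r invfM !mulrA ltr_pM2r ?invr_gt0//; lra.
Qed.
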